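(* Let $f$ be a field of characteristic $p\ge0$, $F=f((t))$, and let $n$ be a nonnegative integer. (1) The $G_n$-orbit of a formal power series $h\in F$ is open if and only if $h\in F\setminus f((t^p))$. (2) The statement ''the $G_n$-orbit of $h\in f((t^{p^m}))\setminus f((t^{p^{m+1}}))$ is open in the relative topology of the field $f((t^{p^m}))$'' is true for all $h\in F\setminus f$ if and only if $f$ is a perfect field. (3) All series $h\in F\setminus f((t^p))$ have a polynomial normal form, i.e. $G_n(h)\cap f[t^{-1},t]\ne\emptyset$. (4) All series $h\in F$ have a polynomial normal form if and only if $f$ is a perfect field. (5) Every $G_n$-orbit in $F$ is closed. (6) The canonical projection $\beta:F\to F/G_n$, $h\mapsto G_n(h)$, is closed if and only if either $f$ is a finite field or $p=0$. (7) The orbit space $F/G_n$ can be metrized by a complete metric.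
   Context: $F=f((t))$ carries its usual $t$-adic valuation, filtration and topology, with $f$ discrete. $G_0$ is the group of automorphisms of the field $F$ that fix $f$ pointwise; all elements of $G_0$ are continuous, preserve the valuation, and are determined by their values $g(t)=ct+o(t)$ with $c\in f$, $c\neq 0$. For $n\ge1$, $G_n$ is the subgroup of $g\in G_0$ with $g(t)=t+o(t^n)$, where $o(t^n)$ denotes a series with all terms of degree $>n$. $G_n(h)$ denotes the orbit of $h$. The orbit space $F/G_n$ carries the quotient topology. When $p=0$, $f((t^p))$ is understood as $f$ (i.e. $t^{0}=1$), and $p^0=1$. In (2), for $h\in F\setminus f$, $m\ge 0$ is the integer with $h\in f((t^{p^m}))\setminus f((t^{p^{m+1}}))$. *)

(* Defs.v *)
(* MathComp / MathComp-Analysis world. *)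
From HB Require Import structures.
From mathcomp Require Import all_boot all_order all_algebra.
From mathcomp Require Import generic_quotient zify.
From mathcomp Require Import boolp classical_sets functions cardinality fsbigop.
From mathcomp Require Import reals topology.

Set Implicit Arguments.
Unset Strict Implicit.
Unset Printing Implicit Defensive.
Import Order.TTheory GRing.Theory Num.Theory.
Local Open Scope classical_set_scope.
Local Open Scope ring_scope.

(* The Laurent series \sum_i a_i t^i is given by the function i |-> a_i. *)
Record laurent (f : fieldType) := Laurent {
  lcoef :> int -> f;
  lcoef_bounded : exists N : int, forall i, i < N -> lcoef i = 0 }.

Section LaurentField.
Variable f : fieldType.
Local Notation F := (laurent f).
Implicit Types (a b c : F) (N M : int).

HB.instance Definition _ := gen_eqMixin F.
HB.instance Definition _ := gen_choiceMixin F.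

(* The t-adic valuation of a is at least N. *)
Definition val_ge (N : int) (a : F) := forall i, i < N -> a i = 0.

Lemma val_geW N M a : M <= N -> val_ge N a -> val_ge M a.
Proof. by move=> MN aN i iM; apply: aN; exact: lt_le_trans iM MN. Qed.

Lemma laurent_eq a b : (forall i, a i = b i) -> a = b.
Proof.
case: a b => [a aP] [b bP] /= ab.
have eab : a = b by apply/funext.
by rewrite eab in aP *; rewrite (Prop_irrelevance aP bP).
Qed.

Lemma laurent0_proof : exists N : int, forall i, i < N -> 0 = 0 :> f.
Proof. by exists 0. Qed.
Definition laurent0 : F := Laurent laurent0_proof.

Lemma lopp_proof a : exists N : int, forall i, i < N -> - a i = 0.
Proof.
by case: (lcoef_bounded a) => N aN; exists N => i /aN ->; rewrite oppr0.
Qed.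
Definition lopp a : F := Laurent (lopp_proof a).

Lemma common_bound a b : exists N, val_ge N a /\ val_ge N b.
Proof.
case: (lcoef_bounded a) (lcoef_bounded b) => [N aN] [M bM].
by exists (Num.min N M); split => i; rewrite lt_min => /andP[? ?]; auto.
Qed.

Lemma ladd_proof a b : exists N : int, forall i, i < N -> a i + b i = 0.
Proof.
case: (common_bound a b) => N [aN bN]; exists N => i iN.
by rewrite aN// bN// addr0.
Qed.
Definition ladd a b : F := Laurent (ladd_proof a b).

Fact laddA : associative ladd.
Proof. by move=> a b c; apply: laurent_eq => i /=; rewrite addrA. Qed.
Fact laddC : commutative ladd.
Proof. by move=> a b; apply: laurent_eq => i /=; rewrite addrC. Qed.
Fact ladd0 : left_id laurent0 ladd.
Proof. by move=> a; apply: laurent_eq => i /=; rewrite add0r. Qed.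
Fact laddN : left_inverse laurent0 lopp ladd.
Proof. by move=> a; apply: laurent_eq => i /=; rewrite addNr. Qed.

HB.instance Definition _ := GRing.isZmodule.Build F laddA laddC ladd0 laddN.

(* The sum ranges over all integers; only finitely many terms are nonzero. *)
Definition lmul_coef a b (i : int) : f :=
  \sum_(j \in [set: int]) a j * b (i - j).

(* The coefficients of t^N, ..., t^(N + K - 1), as a polynomial *)
Definition ltrunc N (K : nat) a : {poly f} := \poly_(k < K) a (N + k%:Z).

Lemma lmul_coef_fin N M a b (m : nat) : val_ge N a -> val_ge M b ->
  lmul_coef a b (N + M + m%:Z) =
  \sum_(j < m.+1) a (N + j%:Z) * b (M + (m - j)%N%:Z).
Proof.
move=> aN bM; rewrite /lmul_coef.
rewrite (@fsbigE _ _ _ _ _ [seq N + j%:Z | j <- iota 0 m.+1]).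
- under eq_bigl do rewrite in_setT.
  rewrite -(big_mkord xpredT (fun j => a (N + j%:Z) * b (M + (m - j)%N%:Z))).
  rewrite big_map /index_iota subn0 !big_seq; apply: eq_bigr => j.
  by rewrite mem_iota => jm; congr (_ * b _); lia.
- by rewrite map_inj_uniq ?iota_uniq// => x y /addrI [].
- by [].
- move=> j _ jN.
  case: (ltP j N) => [/aN ->|Nj]; first by rewrite mul0r.
  case: (ltP (N + m%:Z) j) => [Nmj|jNm].
    by rewrite bM ?mulr0//; lia.
  by case/mapP: jN; exists `|j - N|%N; [rewrite mem_iota|]; lia.
Qed.

Lemma lmul_coef_poly N M a b (K m : nat) : val_ge N a -> val_ge M b ->
  (m < K)%N ->
  lmul_coef a b (N + M + m%:Z) = (ltrunc N K a * ltrunc M K b)`_m.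
Proof.
move=> aN bM mK; rewrite (lmul_coef_fin _ aN bM) coefM.
apply: eq_bigr => j _.
have jK : (j < K)%N by exact: leq_ltn_trans (leq_ord j) mK.
by rewrite !coef_poly jK (leq_ltn_trans (leq_subr _ _) mK).
Qed.

Lemma lmul_coef0 N M a b i : val_ge N a -> val_ge M b -> i < N + M ->
  lmul_coef a b i = 0.
Proof.
move=> aN bM iNM; rewrite /lmul_coef fsbig1// => j _.
case: (ltP j N) => [/aN ->|Nj]; first by rewrite mul0r.
by rewrite bM ?mulr0//; lia.
Qed.

Lemma lmul_proof a b : exists N : int, forall i, i < N -> lmul_coef a b i = 0.
Proof.
case: (lcoef_bounded a) (lcoef_bounded b) => [N aN] [M bM].
by exists (N + M) => i; exact: lmul_coef0.
Qed.
Definition lmul a b : F := Laurent (lmul_proof a b).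

Lemma val_ge_lmul N M a b : val_ge N a -> val_ge M b -> val_ge (N + M) (lmul a b).
Proof. by move=> aN bM i; exact: lmul_coef0. Qed.

Lemma int_offset (N i : int) : N <= i -> exists m : nat, i = N + m%:Z.
Proof. by move=> Ni; exists `|i - N|%N; lia. Qed.

Fact lmulC : commutative lmul.
Proof.
move=> a b; apply: laurent_eq => i /=.
case: (lcoef_bounded a) (lcoef_bounded b) => [N aN] [M bM].
case: (ltP i (N + M)) => [iNM|/int_offset[m ->]].
  by rewrite (lmul_coef0 aN bM)// (lmul_coef0 bM aN)// [M + N]addrC.
rewrite (lmul_coef_poly aN bM (ltnSn m)) [N + M]addrC.
by rewrite (lmul_coef_poly bM aN (ltnSn m)) mulrC.
Qed.

Lemma coefM_eql (m : nat) (P Q S : {poly f}) :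
  (forall j, (j <= m)%N -> P`_j = Q`_j) -> (P * S)`_m = (Q * S)`_m.
Proof.
by move=> PQ; rewrite !coefM; apply: eq_bigr => j _; rewrite PQ// -ltnS.
Qed.

Fact lmulA : associative lmul.
Proof.
move=> a b c; apply: laurent_eq => i /=.
case: (lcoef_bounded a) (lcoef_bounded b) (lcoef_bounded c)
  => [N aN] [M bM] [L cL].
have abNM := val_ge_lmul aN bM; have bcML := val_ge_lmul bM cL.
case: (ltP i (N + M + L)) => [iNM|/int_offset[m ->]].
  by rewrite (lmul_coef0 abNM cL)// (lmul_coef0 aN bcML)//; lia.
rewrite (lmul_coef_poly abNM cL (ltnSn m)) -[N + M + L]addrA.
rewrite (lmul_coef_poly aN bcML (ltnSn m)).
rewrite [RHS](@coefM_eql m _ (ltrunc N m.+1 a * ltrunc M m.+1 b)); last first.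
  by move=> j jm; rewrite coef_poly ltnS jm; exact: lmul_coef_poly.
rewrite mulrC [LHS](@coefM_eql m _ (ltrunc M m.+1 b * ltrunc L m.+1 c)).
  by rewrite -[in RHS]mulrA [in RHS]mulrC.
by move=> j jm; rewrite coef_poly ltnS jm; exact: lmul_coef_poly.
Qed.

Fact lmulDl : left_distributive lmul ladd.
Proof.
move=> a b c; apply: laurent_eq => i /=.
case: (common_bound a b) (lcoef_bounded c) => [N [aN bN]] [M cM].
have abN : val_ge N (ladd a b) by move=> j jN /=; rewrite aN// bN// addr0.
case: (ltP i (N + M)) => [iNM|/int_offset[m ->]].
  by rewrite (lmul_coef0 abN cM)// (lmul_coef0 aN cM)// (lmul_coef0 bN cM)// addr0.
rewrite !(lmul_coef_fin _ _ cM)//= -big_split/=.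
by apply: eq_bigr => j _; rewrite mulrDl.
Qed.

Lemma lconst_proof (x : f) :
  exists N : int, forall i, i < N -> (if i == 0 then x else 0) = 0.
Proof. by exists 0 => i i0; rewrite lt_eqF. Qed.
Definition lconst (x : f) : F := Laurent (lconst_proof x).

Fact lmul1 : left_id (lconst 1) lmul.
Proof.
move=> a; apply: laurent_eq => i /=; rewrite /lmul_coef.
rewrite (@fsbigE _ _ _ _ _ [:: 0 : int])//=.
  by rewrite big_cons big_nil in_setT subr0 mul1r addr0.
by move=> j _; rewrite inE => /negbTE ->; rewrite mul0r.
Qed.

Fact lconst1_neq0 : lconst 1 != 0.
Proof.
apply/eqP => /(congr1 (fun a : F => a 0)) /=.
by move/eqP; rewrite oner_eq0.
Qed.

HB.instance Definition _ := GRing.Zmodule_isComNzRing.Build F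
  lmulA lmulC lmul1 lmulDl lconst1_neq0.

Lemma laurent_neq0 a : a != 0 -> exists2 v : int, val_ge v a & a v != 0.
Proof.
move=> a0; case: (lcoef_bounded a) => N aN.
have ex : exists m : nat, a (N + m%:Z) != 0.
  apply: contrapT => /forallNP nz; case/eqP: a0; apply: laurent_eq => i /=.
  case: (ltP i N) => [/aN//|/int_offset[m ->]].
  by apply/eqP/negPn/negP; exact: nz.
case: (ex_minnP ex) => m am min_m; exists (N + m%:Z) => // i iNm.
case: (ltP i N) => [/aN//|/int_offset[k ik]]; rewrite ik.
apply/eqP/negPn/negP => /min_m mk; lia.
Qed.

(* The first n coefficients of the inverse of the power series
   \sum_k u_k t^k *)
Fixpoint psinv_seq (u : nat -> f) (n : nat) : seq f :=
  if n is n'.+1 then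
    let s := psinv_seq u n' in
    rcons s ((u 0%N)^-1 *
             ((n' == 0)%:R - \sum_(j < n') u (n' - j)%N * s`_j))
  else [::].

Lemma size_psinv_seq u n : size (psinv_seq u n) = n.
Proof. by elim: n => //= n IHn; rewrite size_rcons IHn. Qed.

Lemma nth_psinv_seq u n k : (k < n)%N ->
  (psinv_seq u n)`_k = (psinv_seq u k.+1)`_k.
Proof.
elim: n => // n IHn kn; case: (ltngtP k n) => [kltn|nk|->]//; last by lia.
by rewrite -IHn//= nth_rcons size_psinv_seq kltn.
Qed.

Lemma psinvP u m : u 0%N != 0 ->
  \sum_(j < m.+1) u (m - j)%N * (psinv_seq u j.+1)`_j = (m == 0)%:R.
Proof.
move=> u0; rewrite big_ord_recr/= subnn nth_rcons size_psinv_seq ltnn eqxx.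
rewrite mulrA divff// mul1r addrC -addrA [X in _ + X](_ : _ = 0) ?addr0//.
rewrite addrC; apply/eqP; rewrite subr_eq0; apply/eqP/eq_bigr => j _.
by rewrite [in RHS]nth_psinv_seq.
Qed.

Lemma laurent_inv_ex a : a != 0 -> exists b, b * a = 1.
Proof.
move=> /laurent_neq0[v av av0].
pose u k := a (v + k%:Z).
have u0 : u 0%N != 0 by rewrite /u addr0.
pose g (i : int) := if i < - v then 0 else (psinv_seq u (absz (i + v)).+1)`_(absz (i + v)).
have gP : exists N : int, forall i, i < N -> g i = 0.
  by exists (- v) => i iv; rewrite /g iv.
pose b := Laurent gP; have bv : val_ge (- v) b by move=> i iv /=; rewrite /g iv.
exists b; apply: laurent_eq => i; rewrite -[LHS]/(lmul_coef b a i) /=.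
case: (ltP i (- v + v)) => [iv|/int_offset[m im]].
  by rewrite (lmul_coef0 bv av)// lt_eqF//; lia.
rewrite im (lmul_coef_fin _ bv av).
have -> : (if - v + v + m%:Z == 0 then 1 else 0) = (m == 0)%:R :> f.
  by rewrite addNr add0r; case: m {im}.
rewrite -(psinvP m u0); apply: eq_bigr => j _; rewrite mulrC /u /=; congr (_ * _).
rewrite /g ifF; last by lia.
by rewrite (_ : absz (- v + j%:Z + v) = j)//; lia.
Qed.

Definition linv a : F := xget 0 [set b | b * a = 1].

Fact lmulV a : a != 0 -> linv a * a = 1.
Proof. by move=> /laurent_inv_ex [b ba]; exact: (@xgetI _ 0 [set b | b * a = 1] b). Qed.

Fact linv0 : linv 0 = 0.
Proof.
rewrite /linv xgetPN// => b /=; rewrite mulr0 => /eqP.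
by rewrite eq_sym oner_eq0.
Qed.

HB.instance Definition _ := GRing.ComNzRing_isField.Build F lmulV linv0.

Definition tadic_open : set_system F :=
  [set U | forall h, U h -> exists N, forall k, val_ge N (k - h) -> U k].

Fact tadic_openT : tadic_open setT.
Proof. by move=> h _; exists 0. Qed.

Fact tadic_openI : setI_closed tadic_open.
Proof.
move=> U V oU oV h [/oU[N NU] /oV[M MV]]; exists (Num.max N M) => k kh.
by split; [apply: NU|apply: MV]; apply: val_geW kh; rewrite le_max lexx ?orbT.
Qed.

Fact tadic_open_bigU (I : Type) (U : I -> set F) :
  (forall i, tadic_open (U i)) -> tadic_open (\bigcup_i U i).
Proof.
move=> oU h [i _ /oU[N NU]]; exists N => k /NU Uk; by exists i.
Qed.

HB.instance Definition _ := isOpenTopological.Build F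
  tadic_openT tadic_openI tadic_open_bigU.

Lemma lX_proof : exists N : int, forall i, i < N -> (i == 1)%:R = 0 :> f.
Proof. by exists 0 => i i0; rewrite (_ : (i == 1) = false)//; lia. Qed.

(* The uniformizer t *)
Definition lX : F := Laurent lX_proof.

(* The subfield f((t^k)). For k = 0 this is the field f of constants, as the
   only multiple of 0 is 0. *)
Definition laurent_pow (k : nat) : set F :=
  [set h | forall i, ~~ (k%:Z %| i)%Z -> h i = 0].

(* f[t^-1, t] *)
Definition laurent_poly : set F :=
  [set h : F | exists N : int, forall i, N < i -> h i = 0].

(* G_0. No continuity is required: it is automatic. *)
Definition Gal0 : set {rmorphism F -> F} :=
  [set g | bijective g /\ forall x : f, g (lconst x) = lconst x].

(* G_n: for n >= 1, g(t) - t has only terms of degree > n. *)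
Definition Gal (n : nat) : set {rmorphism F -> F} :=
  [set g | Gal0 g /\ ((0 < n)%N -> val_ge n.+1%:Z (g lX - lX))].

Definition Gorbit (n : nat) (h : F) : set F := [set g h | g in Gal n].

(* The set of G_n-orbits, as a set of subsets of F *)
Record orbit_type (n : nat) := OrbitType {
  orbit_set :> set F;
  orbit_setP : exists h, orbit_set = Gorbit n h }.

Definition orbit_of (n : nat) (h : F) : orbit_type n :=
  OrbitType (ex_intro _ h erefl).

Definition orbit_repr (n : nat) (A : orbit_type n) : F :=
  projT1 (cid (orbit_setP A)).

Fact orbit_reprK n : cancel (@orbit_repr n) (@orbit_of n).
Proof.
move=> A; rewrite /orbit_repr; case: cid => h /=; case: A => A AP /= Ah.
by subst A; congr OrbitType; exact: Prop_irrelevance.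
Qed.

HB.instance Definition _ n :=
  isQuotient.Build F (orbit_type n) (@orbit_reprK n).

(* F / G_n with the quotient topology *)
Definition orbit_space (n : nat) := quotient_topology (orbit_type n).

HB.instance Definition _ n := Topological.on (orbit_space n).

Definition orbit_proj (n : nat) : F -> orbit_space n := @orbit_of n.

Lemma orbit_projE n h : orbit_proj n h = (\pi_(orbit_type n) h)%qT.
Proof. by rewrite unlock. Qed.

Lemma open_orbit_spaceE n (U : set (orbit_space n)) :
  open U = open (orbit_proj n @^-1` U).
Proof.
rewrite /open/= /quotient_open; congr open.
by apply/seteqP; split => h /=; rewrite orbit_projE.
Qed.

End LaurentField.

Definition relatively_open (T : topologicalType) (D A : set T) :=
  exists2 U, open U & A = U `&` D.

Definition closed_map (T U : topologicalType) (g : T -> U) :=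
  forall A, closed A -> closed (g @` A).

Definition has_characteristic (f : fieldType) (p : nat) :=
  p \in [pchar f] \/ (p = 0%N /\ [pchar f] =i pred0).

(* Vacuous, hence true, in characteristic zero *)
Definition perfect_field (f : fieldType) :=
  forall p, p \in [pchar f] -> forall x : f, exists y, y ^+ p = x.

Section Metrization.
Variables (R : realType) (T : Type) (d : T -> T -> R).

Definition is_metric :=
  [/\ forall x y, 0 <= d x y, forall x y, d x y = 0 <-> x = y,
      forall x y, d x y = d y x &
      forall x y z, d x z <= d x y + d y z].

Definition metric_open (U : set T) :=
  forall x, U x -> exists2 e, 0 < e & forall y, d x y < e -> U y.

Definition metric_complete := forall u : nat -> T,
  (forall e, 0 < e -> exists N, forall m k, (N <= m)%N -> (N <= k)%N ->
     d (u m) (u k) < e) ->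
  exists l, forall e, 0 < e -> exists N, forall m, (N <= m)%N -> d (u m) l < e.

End Metrization.

Definition completely_metrizable (R : realType) (T : topologicalType) :=
  exists d : T -> T -> R,
    [/\ is_metric d, forall U : set T, open U <-> metric_open d U &
        metric_complete d].

(* Main.v *)
Require Import Defs.
From HB Require Import structures.
From mathcomp Require Import all_boot all_order all_algebra.
From mathcomp Require Import boolp classical_sets functions cardinality fsbigop.
From mathcomp Require Import reals topology.
From mathcomp Require Import zify.
From Stdlib Require Import Ring.

(** The argument rests on two facts about [F = f((t))]: it is complete, and
    each automorphism over [f] preserves the valuation and is the substitution
    of the image [s] of [t] ([Gal_has_val], [Gal_eq]); conversely every [s] of
    valuation one occurs ([exists_Gal0]).  Hence [G_n] acts by isometries and
    can be handled through the single series [s].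

    Openness is Hensel's lemma.  The chain rule [lderiv_Gal] shows that orbits
    do not mix series with zero and nonzero derivative, and the derivative of
    [h] vanishes exactly when [h] lies in [f((t^p))], in every characteristic
    ([laurent_powP]).  If it does not vanish, Newton iteration solves
    [h (s) = k] for every [k] close to [h] ([Gorbit_ball]); the orbit is open
    and so contains a truncation of [h].  If it vanishes, adding a monomial of
    degree prime to [p] leaves the orbit.  Over a perfect field a nonconstant
    [h] is a [p^m]-th power of a series with nonzero derivative, and powers
    commute with automorphisms ([perfect_orbit_ball]).  When [x] is not a
    [p]-th power, [t^p + x t^(p M)] is not in the orbit of [t^p], as
    [g (t)^p] has only [p]-th powers as coefficients, and
    [t^p + x / (1 - t)^p] has no polynomial normal form
    ([perfect_of_normal_form]).

    Closedness of orbits is a compactness argument.  Suppose automorphisms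
    [g_N] move [h] ever closer to [k].  Divided differences bound the number of
    far apart points at which [h] takes nearly the same value ([few_preimages]),
    so only finitely many possibilities for each digit of [g_N (t)] matter and
    Koenig's lemma yields a limit [s]; substituting [s] moves [h] to [k]
    ([Gorbit_limit]).  Over a finite field the digits are finite in number
    anyway, and the same argument shows that the saturation of a closed set is
    closed; in characteristic zero this holds because nonconstant orbits are
    open and constants are fixed.  For infinite [f] of positive characteristic
    [not_closed_saturation] gives a counterexample.

    Finally, closed orbits of a group of isometries are separated by their
    distance, this distance induces the quotient topology since the projection
    is open, and Cauchy sequences of orbits lift to Cauchy sequences of
    series. *)

Set Implicit Arguments.
Unset Strict Implicit.
Unset Printing Implicit Defensive.
Import Order.TTheory GRing.Theory Num.Theory.
Local Open Scope classical_set_scope.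
Local Open Scope ring_scope.

(** * Valuation, monomials and completeness *)

Section Valuation.
Variable f : fieldType.
Local Notation F := (laurent f).
Implicit Types (a b s h x y : F) (N M i j v w : int) (c d : f).

Definition laurent1 : F := lconst 1.

Lemma laurent_ring_theory :
  ring_theory (laurent0 f) laurent1 (@ladd f) (@lmul f)
    (fun a b => ladd a (lopp b)) (@lopp f) eq.
Proof.
split; [exact: ladd0|exact: laddC|exact: laddA|exact: lmul1|exact: lmulC|
  exact: lmulA|exact: lmulDl|by []|].
by move=> a; rewrite laddC; exact: laddN.
Qed.

(** Puts a variable, whose type is [laurent f] itself, on the left-hand side,
    where [ring] reads off the type of the equation. *)
Lemma laurent_eq_shift a b : (forall x, x = ladd (ladd x (lopp a)) b) -> a = b.
Proof. by move=> /(_ a) {1}->; rewrite [ladd a _]laddC laddN ladd0. Qed.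

Lemma lcoefD a b i : (a + b) i = a i + b i. Proof. by []. Qed.
Lemma lcoefN a i : (- a) i = - a i. Proof. by []. Qed.
Lemma lcoefB a b i : (a - b) i = a i - b i. Proof. by []. Qed.
Lemma lcoef0 i : (0 : F) i = 0. Proof. by []. Qed.
Lemma lcoef1 i : (1 : F) i = (i == 0)%:R.
Proof. by rewrite -[LHS]/(if i == 0 then 1 else 0); case: eqP. Qed.

Lemma lcoef_sum (I : Type) (r : seq I) (P : pred I) (G : I -> F) i :
  (\sum_(k <- r | P k) G k) i = \sum_(k <- r | P k) G k i.
Proof.
exact: (big_morph (fun a : F => a i) (fun a b => lcoefD a b i) (lcoef0 i)).
Qed.

Lemma val_geD N a b : val_ge N a -> val_ge N b -> val_ge N (a + b).
Proof. by move=> aN bN i iN; rewrite lcoefD aN// bN// addr0. Qed.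

Lemma val_geN N a : val_ge N a -> val_ge N (- a).
Proof. by move=> aN i iN; rewrite lcoefN aN// oppr0. Qed.

Lemma val_geB N a b : val_ge N a -> val_ge N b -> val_ge N (a - b).
Proof. by move=> aN bN; apply/val_geD/val_geN. Qed.

Lemma val_geBC N a b : val_ge N (a - b) -> val_ge N (b - a).
Proof. by move=> /val_geN; rewrite opprB. Qed.

Lemma val_ge_trans N a b s : val_ge N (a - b) -> val_ge N (b - s) ->
  val_ge N (a - s).
Proof. by move=> ab bc; have := val_geD ab bc; rewrite addrA subrK. Qed.

Lemma val_ge_sum (I : Type) (r : seq I) (P : pred I) (G : I -> F) N :
  (forall k, P k -> val_ge N (G k)) -> val_ge N (\sum_(k <- r | P k) G k).
Proof. by move=> GN; apply: (big_ind (val_ge N)) => // *; exact: val_geD. Qed.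

Lemma val_geM N M a b : val_ge N a -> val_ge M b -> val_ge (N + M) (a * b).
Proof. exact: val_ge_lmul. Qed.

Lemma val_ge1 : val_ge 0 (1 : F).
Proof. by move=> i i0; rewrite lcoef1 lt_eqF. Qed.

Lemma val_geX N a n : val_ge N a -> val_ge (N *+ n) (a ^+ n).
Proof.
move=> aN; elim: n => [|n IHn]; first by rewrite expr0 mulr0n; exact: val_ge1.
by rewrite exprS mulrS; exact: val_geM.
Qed.

Lemma val_ge_eq0 a : (forall N, val_ge N a) -> a = 0.
Proof. by move=> aN; apply: laurent_eq => i; apply: (aN (i + 1)); lia. Qed.

Lemma val_geS N a : val_ge N a -> a N = 0 -> val_ge (N + 1) a.
Proof.
move=> aN a0 i iN; case: (ltP i N) => [/aN//|Ni].
by rewrite (_ : i = N)//; lia.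
Qed.

Lemma lcoefM_lead N M a b : val_ge N a -> val_ge M b ->
  (a * b) (N + M) = a N * b M.
Proof.
move=> aN bM; have := lmul_coef_fin 0 aN bM.
by rewrite big_ord1 subnn !addr0.
Qed.

(** The valuation as a relation, so that nothing needs to be said of the
    valuation of zero. *)
Definition has_val v a := val_ge v a /\ a v != 0.

Lemma has_val_neq0 v a : has_val v a -> a != 0.
Proof. by case=> _; apply: contra => /eqP ->. Qed.

Lemma has_val_ex a : a != 0 -> exists v, has_val v a.
Proof. by move=> /laurent_neq0[v]; exists v. Qed.

Lemma has_valM v w a b : has_val v a -> has_val w b -> has_val (v + w) (a * b).
Proof.
move=> [av a0] [bw b0]; split; first exact: val_geM.
by rewrite lcoefM_lead// mulf_neq0.
Qed.

Lemma has_val_ge v N a : has_val v a -> val_ge N a -> N <= v.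
Proof.
move=> [_ av] aN; rewrite leNgt; apply: contra av => vN.
by rewrite aN.
Qed.

Lemma has_val_uniq v w a : has_val v a -> has_val w a -> v = w.
Proof.
by move=> av aw; apply/le_anti; rewrite (has_val_ge av aw.1) (has_val_ge aw av.1).
Qed.

Lemma has_val1 : has_val 0 (1 : F).
Proof. by split; [exact: val_ge1|rewrite lcoef1 oner_neq0]. Qed.

Lemma has_valV v a : has_val v a -> has_val (- v) a^-1.
Proof.
move=> av; have a0 := has_val_neq0 av.
have [w aw] : exists w, has_val w a^-1 by apply: has_val_ex; rewrite invr_eq0.
have := has_valM av aw; rewrite divff// => /(has_val_uniq has_val1) vw.
by rewrite (_ : - v = w)//; lia.
Qed.

Lemma has_valX v a n : has_val v a -> has_val (v *+ n) (a ^+ n).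
Proof.
move=> av; elim: n => [|n IHn]; first exact: has_val1.
by rewrite exprS mulrS; exact: has_valM.
Qed.

Lemma has_valXz v a i : has_val v a -> has_val (v * i) (a ^ i).
Proof.
move=> av; case: i => n; first by rewrite -exprnP -natz mulr_natr; exact: has_valX.
rewrite NegzE -exprnN mulrN; apply: has_valV.
by rewrite -natz mulr_natr; exact: has_valX.
Qed.

Lemma val_ge_div N v a b : val_ge N a -> has_val v b -> val_ge (N - v) (a / b).
Proof. by move=> aN /has_valV[bv _]; exact: val_geM. Qed.

Lemma has_valD v a b : has_val v a -> val_ge (v + 1) b -> has_val v (a + b).
Proof.
move=> [av a0] bv; split.
  by apply: val_geD => //; apply: val_geW bv; lia.
by rewrite lcoefD (bv v) ?addr0//; lia.
Qed.

Lemma has_val_close v a b : has_val v a -> val_ge (v + 1) (b - a) -> has_val v b.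
Proof. by move=> av ba; rewrite -(subrK a b) addrC; exact: has_valD. Qed.

Lemma val_geP N a : a = 0 \/ (exists2 v, has_val v a & N <= v) \/
  (exists2 v, has_val v a & v < N).
Proof.
have [->|/has_val_ex[v av]] := eqVneq a 0; first by left.
by right; case: (leP N v) => ?; [left|right]; exists v.
Qed.

Lemma lmono_proof c i : exists N : int, forall j, j < N ->
  (if j == i then c else 0) = 0.
Proof. by exists i => j ji; rewrite lt_eqF. Qed.

Definition lmono c i : F := Laurent (lmono_proof c i).

Lemma lmonoE c i j : lmono c i j = if j == i then c else 0. Proof. by []. Qed.

Lemma val_ge_lmono c i : val_ge i (lmono c i).
Proof. by move=> j ji; rewrite lmonoE lt_eqF. Qed.

Lemma lcoef_lmonoM c i a j : (lmono c i * a) j = c * a (j - i).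
Proof.
rewrite -[LHS]/(lmul_coef (lmono c i) a j) /lmul_coef.
rewrite (@fsbigE _ _ _ _ _ [:: i])//=.
  by rewrite big_cons big_nil in_setT eqxx addr0.
by move=> k _; rewrite inE => /negbTE ->; rewrite mul0r.
Qed.

Lemma lmonoM c d i j : lmono c i * lmono d j = lmono (c * d) (i + j).
Proof.
apply: laurent_eq => k; rewrite lcoef_lmonoM !lmonoE subr_eq [j + i]addrC.
by case: ifP => //; rewrite mulr0.
Qed.

Lemma lconstE c : lconst c = lmono c 0. Proof. exact: laurent_eq. Qed.
Lemma lXE : lX f = lmono 1 1.
Proof. by apply: laurent_eq => i; rewrite lmonoE /=; case: ifP. Qed.

Lemma lcoef_lconstM c a i : (lconst c * a) i = c * a i.
Proof. by rewrite lconstE lcoef_lmonoM subr0. Qed.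

Lemma val_ge_lconst c : val_ge 0 (lconst c).
Proof. by rewrite lconstE; exact: val_ge_lmono. Qed.

Lemma val_ge_lconstM c N a : val_ge N a -> val_ge N (lconst c * a).
Proof. by move=> aN i iN; rewrite lcoef_lconstM aN// mulr0. Qed.

Lemma lconst1 : lconst 1 = 1 :> F. Proof. by []. Qed.

Lemma has_val_lX : has_val 1 (lX f).
Proof. by rewrite lXE; split; [exact: val_ge_lmono|rewrite lmonoE oner_neq0]. Qed.

Lemma lX_neq0 : lX f != 0. Proof. exact: has_val_neq0 has_val_lX. Qed.

Lemma lmonoS c i : lmono c (i + 1) = lmono c i * lX f.
Proof. by rewrite lXE lmonoM mulr1. Qed.

Lemma lmonoXz c i : lmono c i = lconst c * lX f ^ i.
Proof.
elim/int_rect: i => [|n IHn|n IHn]; first by rewrite expr0z mulr1 lconstE.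
  by rewrite -addn1 PoszD lmonoS IHn expfzDr ?lX_neq0// expr1z mulrA.
have e : - n.+1%:Z + 1 = - n%:Z by lia.
apply: (mulIf lX_neq0); rewrite -lmonoS -mulrA -[X in _ * (_ * X)]expr1z.
by rewrite -expfzDr ?lX_neq0// e.
Qed.

Definition ltail w (K : nat) h : F :=
  h - \sum_(k < K) lmono (h (w + k%:Z)) (w + k%:Z).

Lemma val_ge_ltail w K h : val_ge w h -> val_ge (w + K%:Z) (ltail w K h).
Proof.
rewrite /ltail; elim: K => [hw|K IHK hw].
  by rewrite big_ord0 !subr0.
rewrite big_ord_recr/= opprD addrA -addn1 PoszD addrA; apply: val_geS.
  by apply: val_geB; [exact: IHK|exact: val_ge_lmono].
rewrite !lcoefB lmonoE eqxx lcoef_sum big1 ?subr0 ?subrr// => k _.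
by rewrite lmonoE ifF//; have := ltn_ord k; lia.
Qed.

Definition continuous0 (phi : F -> F) :=
  forall M, exists N, forall x, val_ge N x -> val_ge M (phi x).

(** A series is the limit of its partial sums, so a valuation bound for an
    additive map that is continuous at zero need only be checked on
    monomials.  Every identity and estimate for automorphisms of [F] below is
    obtained in this way. *)
Lemma termwise (phi : F -> F) M w h : {morph phi : x y / x + y} ->
  continuous0 phi ->
  (forall c i, w <= i -> val_ge M (phi (lmono c i))) ->
  val_ge w h -> val_ge M (phi h).
Proof.
move=> phiD /(_ M)[N phiN] phim hw.
have phi0 : phi 0 = 0 by apply: (addIr (phi 0)); rewrite -phiD !add0r.
(* the tail beyond [K] terms has valuation at least [N] *)
pose K := absz (N - w).
rewrite -(subrK (\sum_(k < K) lmono (h (w + k%:Z)) (w + k%:Z)) h) phiD.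
rewrite (big_morph phi phiD phi0); apply: val_geD.
  by apply/phiN/(val_geW _ (val_ge_ltail hw)); rewrite /K; lia.
by apply: val_ge_sum => k _; apply: phim; lia.
Qed.

Lemma termwise0 (phi : F -> F) h : {morph phi : x y / x + y} ->
  continuous0 phi -> (forall c i, phi (lmono c i) = 0) -> phi h = 0.
Proof.
move=> phiD phic phi0; apply: val_ge_eq0 => M; case: (lcoef_bounded h) => w.
by apply: termwise => // c i _; rewrite phi0.
Qed.

Lemma int_shift_ind (P : int -> Prop) : P 0 ->
  (forall i, P i -> P (i + 1)) -> (forall i, P (i + 1) -> P i) -> forall i, P i.
Proof.
move=> P0 Pup Pdown; elim/int_rect => // n Pn.
  by rewrite -addn1 PoszD; exact: Pup.
by apply: Pdown; rewrite (_ : - _ + 1 = - n%:Z)//; lia.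
Qed.

Lemma laurent_complete (u : nat -> F) N :
  (forall k, val_ge (N + k%:Z) (u k.+1 - u k)) ->
  exists l, forall k, val_ge (N + k%:Z) (l - u k).
Proof.
move=> uN.
have um k m : (k <= m)%N -> val_ge (N + k%:Z) (u m - u k).
  elim: m => [|m IHm]; first by rewrite leqn0 => /eqP ->; rewrite subrr.
  rewrite leq_eqVlt ltnS => /orP[/eqP->|km]; first by rewrite subrr.
  by apply: val_ge_trans (IHm km); apply: val_geW (uN m); lia.
(* the coefficient of degree [i] no longer changes after the term [u (r i)] *)
pose r i := absz (Num.max 0 (i - N + 1)).
have lP : exists L, forall i, i < L -> u (r i) i = 0.
  case: (lcoef_bounded (u 0%N)) => L uL; exists (Num.min L N) => i.
  rewrite lt_min => /andP[iL iN].
  by rewrite (_ : r i = 0%N) ?uL// /r; lia.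
exists (Laurent lP) => k i ik; rewrite lcoefB /=; apply/eqP; rewrite subr_eq0.
have rk : (r i <= k)%N by rewrite /r; lia.
have /(_ i) := um _ _ rk; rewrite lcoefB => /(_ _)/eqP; rewrite subr_eq0.
by rewrite eq_sym; apply; rewrite /r; lia.
Qed.

(** Newton iteration: if every approximate solution in the ball can be
    improved by one digit by a change of valuation at least [N + c], then the
    improvements converge to a solution.  The shift [c] accounts for the
    derivative of [Psi]: it is minus the valuation of that derivative. *)
Lemma newton (Psi : F -> F) (c : int) y N0 x0 :
  (forall x, val_ge (N0 + c) (x - x0) -> forall M, exists j, forall x',
     val_ge (N0 + c) (x' - x0) -> val_ge j (x' - x) ->
     val_ge M (Psi x' - Psi x)) ->
  (forall N x, N0 <= N -> val_ge (N0 + c) (x - x0) -> val_ge N (Psi x - y) ->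
     exists2 x', val_ge (N + c) (x' - x) & val_ge (N + 1) (Psi x' - y)) ->
  val_ge N0 (Psi x0 - y) ->
  exists2 x, val_ge (N0 + c) (x - x0) & Psi x = y.
Proof.
move=> Psic step Psi0.
pose good (k : nat) x :=
  val_ge (N0 + c) (x - x0) /\ val_ge (N0 + k%:Z) (Psi x - y).
have next kx : exists x', good kx.1 kx.2 ->
    good kx.1.+1 x' /\ val_ge (N0 + c + kx.1%:Z) (x' - kx.2).
  case: kx => k x; rewrite /=; case: (pselect (good k x)) => [[xb xk]|ng].
    case: (step (N0 + k%:Z) x _ xb xk); first by lia.
    move=> x' x'x x'y; exists x' => _; split; last first.
      by apply: val_geW x'x; lia.
    split; last by apply: val_geW x'y; lia.
    by apply: val_ge_trans xb; apply: val_geW x'x; lia.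
  by exists 0.
pose nx kx := projT1 (cid (next kx)).
pose u := fix u k := if k is k'.+1 then nx (k', u k') else x0.
have gu k : good k (u k).
  elim: k => [|k IHk]; first by split; rewrite ?subrr// addr0.
  by rewrite /= /nx; case: cid => x' /= /(_ IHk)[].
have [l lu] := @laurent_complete u (N0 + c)
  (fun k => (projT2 (cid (next (k, u k))) (gu k)).2).
have lb : val_ge (N0 + c) (l - x0) by have := lu 0%N; rewrite addr0.
exists l => //; apply/eqP; rewrite -subr_eq0; apply/eqP/val_ge_eq0 => M.
have [j jM] := Psic l lb M.
pose k := absz (Num.max 0 (Num.max (j - N0 - c) (M - N0))).
apply: (@val_ge_trans _ _ (Psi (u k))).
  apply/val_geBC/jM; first exact: (gu k).1.
  by apply/val_geBC/(val_geW _ (lu k)); rewrite /k; lia.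
by apply: val_geW (gu k).2; rewrite /k; lia.
Qed.
End Valuation.
Arguments val_ge_lmono {f} c i.
Arguments val_ge_lconst {f} c.
Arguments val_geX {f N a} n _.

(** Inferred ring structures on [laurent f] agree only up to conversion, whereas
    [ring] compares operations and types syntactically; so each operation is
    first restated as the one occurring in [laurent_ring_theory]. *)
Ltac lring :=
  apply: laurent_eq_shift; let x := fresh in intro x;
  let f := lazymatch goal with |- @eq (laurent ?f) _ _ => f end in
  repeat match goal with
  | |- context [@Algebra.add ?M ?a ?b] =>
    change (@Algebra.add M a b) with (ladd a b)
  | |- context [@Algebra.opp ?M ?a] => change (@Algebra.opp M a) with (lopp a)
  | |- context [@GRing.mul ?M ?a ?b] =>
    change (@GRing.mul M a b) with (lmul a b)
  | |- context [@Algebra.zero ?M] =>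
    change (@Algebra.zero M) with (laurent0 f)
  | |- context [@GRing.one ?M] => change (@GRing.one M) with (laurent1 f)
  end; ring.

(** * Substitution of a series of valuation one for t *)

Section Substitution.
Variables (f : fieldType) (s : laurent f).
Hypothesis s1 : has_val 1 s.
Local Notation F := (laurent f).
Implicit Types (h x y : F) (N M i j : int) (c : f).
Add Ring laurent_ring : (laurent_ring_theory f).

Let has_val_sXz j : has_val j (s ^ j).
Proof. by have := has_valXz j s1; rewrite mul1r. Qed.

Definition subst_coef h i : f := \sum_(j \in [set: int]) h j * (s ^ j) i.

Lemma subst_coef_fin N h (K : nat) i : val_ge N h -> i < N + K%:Z ->
  subst_coef h i = \sum_(k < K) h (N + k%:Z) * (s ^ (N + k%:Z)) i.
Proof.
move=> hN iK; rewrite /subst_coef.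
rewrite (@fsbigE _ _ _ _ _ [seq N + k%:Z | k <- iota 0 K]).
- under eq_bigl do rewrite in_setT.
  rewrite -(big_mkord xpredT (fun k => h (N + k%:Z) * (s ^ (N + k%:Z)) i)).
  by rewrite big_map /index_iota subn0.
- by rewrite map_inj_uniq ?iota_uniq// => x y /addrI [].
- by [].
- move=> j _ jN; case: (ltP j N) => [/hN ->|Nj]; first by rewrite mul0r.
  case: (ltP i j) => [ij|ji]; first by rewrite ((has_val_sXz j).1 i ij) mulr0.
  by case/mapP: jN; exists `|j - N|%N; [rewrite mem_iota|]; lia.
Qed.

Lemma val_ge_subst_coef N h i : val_ge N h -> i < N -> subst_coef h i = 0.
Proof.
by move=> hN iN; rewrite (@subst_coef_fin N h 0) ?big_ord0//; lia.
Qed.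

Lemma subst_proof h : exists N : int, forall i, i < N -> subst_coef h i = 0.
Proof.
by case: (lcoef_bounded h) => N hN; exists N => i; exact: val_ge_subst_coef.
Qed.

Definition subst h : F := Laurent (subst_proof h).

Lemma val_ge_subst N h : val_ge N h -> val_ge N (subst h).
Proof. by move=> hN i; exact: val_ge_subst_coef. Qed.

Lemma substD : {morph subst : h k / h + k}.
Proof.
move=> h k; apply: laurent_eq => i; rewrite lcoefD /=.
have [N [hN kN]] := common_bound h k.
have iK : i < N + (absz (i - N)).+1%:Z by lia.
rewrite (subst_coef_fin hN iK) (subst_coef_fin kN iK).
rewrite (subst_coef_fin (val_geD hN kN) iK) -big_split/=.
by apply: eq_bigr => j _; rewrite mulrDl.
Qed.

Lemma subst_lmono c i : subst (lmono c i) = lconst c * s ^ i.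
Proof.
apply: laurent_eq => j; rewrite lcoef_lconstM /= /subst_coef.
rewrite (@fsbigE _ _ _ _ _ [:: i])//=.
  by rewrite big_cons big_nil in_setT eqxx addr0.
by move=> k _; rewrite inE => /negbTE ->; rewrite mul0r.
Qed.

Lemma substB : GRing.zmod_morphism subst.
Proof.
move=> h k; apply: (addIr (subst k)).
by rewrite -substD !subrK.
Qed.

(** Multiplicativity is checked on monomials in one factor at a time. *)
Lemma subst_monoM c i k : subst (lmono c i * k) = subst (lmono c i) * subst k.
Proof.
apply/eqP; rewrite -subr_eq0; apply/eqP.
apply: (termwise0
  (phi := fun k => subst (lmono c i * k) - subst (lmono c i) * subst k)).
- by move=> x y; rewrite mulrDr !substD; lring.
- move=> M; exists (M - i) => x xM; apply: val_geB.
    by apply: val_geW (val_ge_subst (val_geM (val_ge_lmono c i) xM)); lia.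
  apply: val_geW (val_geM (val_ge_subst (val_ge_lmono c i)) (val_ge_subst xM)).
  by lia.
- move=> d j; rewrite lmonoM !subst_lmono expfzDr ?(has_val_neq0 s1)//.
  have -> : lconst (c * d) = lconst c * lconst d :> F.
    by rewrite !lconstE lmonoM addr0.
  by rewrite mulrACA subrr.
Qed.

Lemma substM : {morph subst : h k / h * k}.
Proof.
move=> h k; apply/eqP; rewrite -subr_eq0; apply/eqP.
apply: (termwise0 (phi := fun h => subst (h * k) - subst h * subst k)).
- by move=> x y; rewrite mulrDl !substD; lring.
- case: (lcoef_bounded k) => L kL M; exists (M - L) => x xM; apply: val_geB.
    by apply: val_geW (val_ge_subst (val_geM xM kL)); lia.
  by apply: val_geW (val_geM (val_ge_subst xM) (val_ge_subst kL)); lia.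
- by move=> c i; rewrite subst_monoM subrr.
Qed.

Lemma subst_lconst c : subst (lconst c) = lconst c.
Proof. by rewrite {1}lconstE subst_lmono expr0z mulr1. Qed.

Lemma subst_monoid_morphism : GRing.monoid_morphism subst.
Proof. by split; [rewrite -lconst1 subst_lconst|exact: substM]. Qed.

HB.instance Definition _ := GRing.isZmodMorphism.Build F F subst substB.
HB.instance Definition _ :=
  GRing.isMonoidMorphism.Build F F subst subst_monoid_morphism.

(** The leading coefficient of [s ^ N] is nonzero, so a monomial of degree [N]
    corrects the digit of degree [N]. *)
Lemma subst_surj y : exists x, subst x = y.
Proof.
case: (lcoef_bounded y) => N0 yN0.
suff [x _ xy] : exists2 x, val_ge (N0 + 0) (x - 0) & subst x = y by exists x.
apply: newton.
- move=> x _ M; exists M => x' _ x'x.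
  by rewrite -substB; exact: val_ge_subst.
- move=> N x _ _ xy; have [sN sN0] := has_val_sXz N.
  exists (x - lmono ((subst x - y) N / (s ^ N) N) N).
    by rewrite addr0 [x - _]addrC addrK; apply/val_geN/val_ge_lmono.
  rewrite substB subst_lmono addrAC; apply: val_geS.
    by apply: val_geB => //; exact: val_ge_lconstM.
  by rewrite [LHS]lcoefB lcoef_lconstM divfK// subrr.
- by rewrite (rmorph0 subst) sub0r; exact: val_geN.
Qed.

Lemma subst_Gal0 : Gal0 (subst : {rmorphism F -> F}).
Proof.
split; last exact: subst_lconst.
pose inv y := projT1 (cid (subst_surj y)).
have invK : cancel inv subst by move=> y; exact: projT2 (cid (subst_surj y)).
by exists inv => // x; apply: (fmorph_inj subst); exact: invK.
Qed.

Lemma exists_Gal0 : exists2 g : {rmorphism F -> F}, Gal0 g & g (lX f) = s.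
Proof.
exists subst; first exact: subst_Gal0.
rewrite lXE; apply: etrans (subst_lmono 1 1) _.
by rewrite expr1z lconst1 mul1r.
Qed.

End Substitution.

(** * Automorphisms over the constants are substitutions *)

Section Automorphisms.
Variable f : fieldType.
Local Notation F := (laurent f).
Implicit Types (g : {rmorphism F -> F})
  (h s x y : F) (N M i j v w : int) (n m : nat) (c : f).
Add Ring laurent_ring : (laurent_ring_theory f).

Lemma val_geXB m N x y : (1 < m)%N -> val_ge 1 x -> val_ge 1 y ->
  val_ge N (x - y) -> val_ge (N + 1) (x ^+ m - y ^+ m).
Proof.
move=> m1 x1 y1 xy; rewrite subrXX; apply: val_geM => //.
apply: val_ge_sum => i _.
apply: val_geW (val_geM (val_geX (m.-1 - i) x1) (val_geX i y1)).
by rewrite -mulrnDr; have := ltn_ord i; lia.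
Qed.

(** Hensel's lemma for [y ^ m + y = x], whose derivative at [0] is [1]
    in every characteristic. *)
Lemma hensel_root m x : (1 < m)%N -> val_ge 1 x -> exists y, y ^+ m + y = x.
Proof.
move=> m1 x1.
suff [y _ yx] : exists2 y, val_ge (1 + 0) (y - 0) & y ^+ m + y = x by exists y.
have sub0 y : val_ge (1 + 0) (y - 0) -> val_ge 1 y by rewrite addr0 subr0.
apply: (newton (Psi := fun y => y ^+ m + y)).
- move=> y /sub0 y1 M; exists M => z /sub0 z1 zy.
  have -> : z ^+ m + z - (y ^+ m + y) = (z ^+ m - y ^+ m) + (z - y) by lring.
  by apply: val_geD => //; apply: val_geW (val_geXB m1 z1 y1 zy); lia.
- move=> N y N1 /sub0 y1 yx; set d := _ - x in yx.
  have zy : val_ge N ((y - d) - y) by rewrite addrAC subrr sub0r; exact: val_geN.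
  exists (y - d); first by rewrite addr0.
  have z1 : val_ge 1 (y - d) by apply: val_geB => //; apply: val_geW yx.
  have -> : (y - d) ^+ m + (y - d) - x = (y - d) ^+ m - y ^+ m.
    by rewrite /d; lring.
  exact: val_geXB.
- rewrite expr0n eqn0Ngt (ltnW m1)/= mulr0n !add0r; exact: val_geN.
Qed.

Definition fixes_const g := forall c, g (lconst c) = lconst c.

Lemma fixing_val_ge0 g x : val_ge 1 x -> val_ge 0 (g x).
Proof.
move=> x1; have [->//|[[v [vg _] v0]|[v gv v0]]] := val_geP 0 (g x).
  exact: val_geW vg.
have m1 : (1 < (absz v).+1)%N by lia.
have [y yx] := hensel_root m1 x1.
have gyx : g y ^+ (absz v).+1 + g y = g x by rewrite -rmorphXn -rmorphD yx.
have [gy0|/has_val_ex[w gw]] := eqVneq (g y) 0.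
  by have := has_val_neq0 gv; rewrite -gyx gy0 expr0n addr0 eqxx.
case: (leP 0 w) => w0.
  have gy0 : val_ge 0 (g y) by exact: val_geW gw.1.
  suff /(has_val_ge gv) : val_ge 0 (g x) by lia.
  rewrite -gyx; apply: val_geD => //.
  by have := val_geX (absz v).+1 gy0; rewrite mul0rn.
suff /(has_val_uniq gv) : has_val (w *+ (absz v).+1) (g x).
  by rewrite -mulr_natr natz; nia.
rewrite -gyx; apply: has_valD; first exact: has_valX.
by apply: val_geW gw.1; rewrite -mulr_natr natz; nia.
Qed.

(** Integrality is algebraic: for [x] of positive valuation, all equations
    [y ^ m + y = x] with [m > 1] are solvable, which forces the valuation of
    [g x] to be nonnegative, as a negative one would be divisible by every
    [m].  A residue [c != 0] of [g x] would make [g (x / (c - x))] have a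
    pole. *)
Lemma fixing_val_ge1 g x : fixes_const g -> val_ge 1 x -> val_ge 1 (g x).
Proof.
move=> gc x1; have gx0 := fixing_val_ge0 g x1.
have [e|c0] := eqVneq (g x 0) 0; first exact: (val_geS gx0 e).
set c := g x 0 in c0; exfalso.
have cx : has_val 0 (lconst c - x).
  by apply: has_valD; [split; first exact: val_ge_lconst|exact: val_geN].
have e1 : val_ge 1 (lconst c - g x).
  apply: (@val_geS _ 0); last by rewrite lcoefB subrr.
  by apply: val_geB => //; exact: val_ge_lconst.
have [w ew] : exists w, has_val w (lconst c - g x).
  apply: has_val_ex; rewrite -gc -rmorphB fmorph_eq0.
  exact: has_val_neq0 cx.
have w1 := has_val_ge ew e1.
have z1 : val_ge 1 (x / (lconst c - x)).
  by have := val_ge_div x1 cx; rewrite subr0.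
have := fixing_val_ge0 g z1; rewrite fmorph_div rmorphB gc.
have gx : has_val 0 (g x) by [].
by move=> /(has_val_ge (has_valM gx (has_valV ew))); lia.
Qed.

Lemma fixing_has_val0 g x : fixes_const g -> has_val 0 x -> has_val 0 (g x).
Proof.
move=> gc [x0 xn0].
have r1 : val_ge 1 (x - lconst (x 0)).
  apply: (@val_geS _ 0); last by rewrite lcoefB subrr.
  by apply: val_geB => //; exact: val_ge_lconst.
rewrite -(subrK (lconst (x 0)) x) rmorphD gc addrC.
apply: has_valD; last exact: fixing_val_ge1.
by split; first exact: val_ge_lconst.
Qed.

Lemma fixing_has_val g x v e : fixes_const g -> has_val e (g (lX f)) ->
  has_val v x -> has_val (e * v) (g x).
Proof.
move=> gc ge xv; have tv := has_valXz v (has_val_lX f).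
have tv0 := has_val_neq0 tv.
rewrite -(divfK tv0 x) [_ / _ * _]mulrC rmorphM fmorphXz -[e * v]addr0.
apply: has_valM; first exact: has_valXz.
apply: fixing_has_val0 => //; have := has_valM xv (has_valV tv).
by rewrite mul1r subrr.
Qed.

(** The valuation of [g t] divides all valuations, and [t] is in the image. *)
Lemma Gal_has_val g x v : Gal0 g -> has_val v x -> has_val v (g x).
Proof.
move=> [[g' _ g'K] gc].
suff g1 : has_val 1 (g (lX f)) by rewrite -{2}[v]mul1r; exact: fixing_has_val.
have [e ge] : exists e, has_val e (g (lX f)).
  by apply: has_val_ex; rewrite fmorph_eq0 lX_neq0.
have e1 := has_val_ge ge (fixing_val_ge1 gc (has_val_lX f).1).
have [w gw] : exists w, has_val w (g' (lX f)).
  by apply: has_val_ex; apply/eqP => e0; have := g'K (lX f); rewrite e0 rmorph0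
    => /esym/eqP; apply/negP/lX_neq0.
have := fixing_has_val gc ge gw; rewrite g'K => /(has_val_uniq (has_val_lX f)).
move=> ew; have w1 : 1 <= w by rewrite leNgt; apply/negP => ?; nia.
by have <- : e = 1 by nia.
Qed.

Lemma Gal_has_val_lX g : Gal0 g -> has_val 1 (g (lX f)).
Proof. by move=> g0; apply/Gal_has_val/has_val_lX. Qed.

Lemma Gal_val_ge g N x : Gal0 g -> val_ge N x -> val_ge N (g x).
Proof.
move=> g0 xN; have [->|/has_val_ex[v xv]] := eqVneq x 0; first by rewrite rmorph0.
by apply: val_geW (Gal_has_val g0 xv).1; exact: has_val_ge xv xN.
Qed.

Lemma Gal_lmono g c i : Gal0 g -> g (lmono c i) = lconst c * g (lX f) ^ i.
Proof. by case=> _ gc; rewrite lmonoXz rmorphM gc fmorphXz. Qed.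

Lemma Gal_eq g g' : Gal0 g -> Gal0 g' -> g (lX f) = g' (lX f) -> g =1 g'.
Proof.
move=> g0 g'0 gg' x; apply/eqP; rewrite -subr_eq0; apply/eqP.
apply: (termwise0 (phi := fun x => g x - g' x)).
- by move=> y z; rewrite !rmorphD; lring.
- by move=> M; exists M => y yM; apply: val_geB; exact: Gal_val_ge.
- by move=> c i; rewrite !Gal_lmono// gg' subrr.
Qed.

Lemma Gal_id n : Gal n (idfun : {rmorphism F -> F}).
Proof. by split; [split=> //; exists id|rewrite subrr]. Qed.

Lemma Gal0_comp g g' : Gal0 g -> Gal0 g' ->
  Gal0 ((g \o g' : F -> F) : {rmorphism F -> F}).
Proof.
move=> [gb gc] [g'b g'c]; split; first exact: bij_comp.
by move=> c; rewrite -[LHS]/(g (g' (lconst c))) g'c gc.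
Qed.

Lemma Gal_comp n g g' : Gal n g -> Gal n g' ->
  Gal n ((g \o g' : F -> F) : {rmorphism F -> F}).
Proof.
move=> [g0 gn] [g'0 g'n]; split; first exact: Gal0_comp.
move=> n0; apply: (@val_ge_trans _ _ _ (g (lX f))); last exact: gn.
by rewrite -[_ - _]/(g (g' (lX f)) - g (lX f)) -rmorphB; apply/Gal_val_ge/g'n.
Qed.

Lemma Gal_inv n g : Gal n g -> exists2 g', Gal n g' & cancel g g' /\ cancel g' g.
Proof.
move=> [g0 gn]; case: (g0) => -[inv invl invr] gc.
have s1 : has_val 1 (inv (lX f)).
  have [v sv] : exists v, has_val v (inv (lX f)).
    by apply: has_val_ex; apply/eqP => e0; have := invr (lX f); rewrite e0 rmorph0
      => /esym/eqP; apply/negP/lX_neq0.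
  have := Gal_has_val g0 sv; rewrite invr.
  by move=> /(has_val_uniq (has_val_lX f)) ->.
have [g' g'0 g's] := exists_Gal0 s1.
have gg' : cancel g' g.
  apply: (Gal_eq (Gal0_comp g0 g'0) (Gal_id 0).1).
  by rewrite /= g's invr.
have g'g : cancel g g' by move=> x; apply: (fmorph_inj g); rewrite gg'.
exists g' => //; split=> // n0; apply: val_geBC.
by have := Gal_val_ge g'0 (gn n0); rewrite rmorphB g'g.
Qed.
End Automorphisms.

(** * Derivatives and open orbits *)

Section Derivative.
Variable f : fieldType.
Local Notation F := (laurent f).
Implicit Types (g : {rmorphism F -> F})
  (h s x y : F) (N M i j v w : int) (n m : nat) (c : f).
Add Ring laurent_ring : (laurent_ring_theory f).

Lemma Gorbit_refl n h : Gorbit n h h.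
Proof. by exists idfun => //; exact: Gal_id. Qed.

Lemma Gorbit_sym n h k : Gorbit n h k -> Gorbit n k h.
Proof. by move=> [g /Gal_inv[g' g'n [g'g _]] <-]; exists g'. Qed.

Lemma Gorbit_trans n h k l : Gorbit n h k -> Gorbit n k l -> Gorbit n h l.
Proof.
by move=> [g gn <-] [g' g'n <-]; exists (g' \o g : F -> F) => //; exact: Gal_comp.
Qed.

Lemma exists_Gal n s : has_val 1 s ->
  ((0 < n)%N -> val_ge n.+1%:Z (s - lX f)) -> exists2 g, Gal n g & g (lX f) = s.
Proof.
by move=> /exists_Gal0[g g0 gs] sn; exists g => //; split => //; rewrite gs.
Qed.

(** Since [s'^i - s^i] is divisible by [(s' - s) t^(i - 1)], also for negative
    [i]. *)
Lemma Gal_lipschitz g g' j w h : Gal0 g -> Gal0 g' ->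
  val_ge j (g' (lX f) - g (lX f)) -> val_ge w h ->
  val_ge (w + j - 1) (g' h - g h).
Proof.
move=> g0 g'0 sj; apply: (termwise (phi := fun h => g' h - g h)).
- by move=> x y; rewrite !rmorphD; lring.
- by move=> M; exists M => x xM; apply: val_geB; exact: Gal_val_ge.
move=> c i wi; suff : val_ge (i + j - 1) (g' (lmono c i) - g (lmono c i)).
  by apply: val_geW; lia.
have sub k : g' (k * lX f) - g (k * lX f) =
    (g' k - g k) * g' (lX f) + g k * (g' (lX f) - g (lX f)).
  by rewrite !rmorphM; lring.
have low k : val_ge (k + j) (g (lmono c k) * (g' (lX f) - g (lX f))).
  by apply: val_geM => //; apply/Gal_val_ge/val_ge_lmono.
have s'1 := Gal_has_val_lX g'0.
elim/int_shift_ind: i {wi} => [|i IHi|i IHi].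
- by rewrite -lconstE g0.2 g'0.2 subrr.
- rewrite lmonoS sub; apply: val_geD; last by apply: val_geW (low i); lia.
  by apply: val_geW (val_geM IHi s'1.1); lia.
rewrite lmonoS sub in IHi.
rewrite -(mulfK (has_val_neq0 s'1) (_ - _)).
apply: val_geW (val_ge_div _ s'1) => [|]; last first.
  rewrite -(addrK (g (lmono c i) * (g' (lX f) - g (lX f))) (_ * _)).
  by apply: val_geB; [exact: IHi|apply: val_geW (low i)]; lia.
by lia.
Qed.

Lemma lderiv_proof h :
  exists N : int, forall i, i < N -> (i + 1)%:~R * h (i + 1) = 0.
Proof.
case: (lcoef_bounded h) => N hN; exists (N - 1) => i iN.
by rewrite hN ?mulr0//; lia.
Qed.

Definition lderiv h : F := Laurent (lderiv_proof h).

Lemma lderivE h i : lderiv h i = (i + 1)%:~R * h (i + 1). Proof. by []. Qed.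

Lemma lderivD : {morph lderiv : x y / x + y}.
Proof.
by move=> x y; apply: laurent_eq => i; rewrite lcoefD !lderivE lcoefD mulrDr.
Qed.

Lemma val_ge_lderiv N h : val_ge N h -> val_ge (N - 1) (lderiv h).
Proof. by move=> hN i iN; rewrite lderivE hN ?mulr0//; lia. Qed.

Lemma lderiv_lconst c : lderiv (lconst c) = 0.
Proof.
apply: laurent_eq => i; rewrite lderivE /=.
by case: eqP => [->|_]; rewrite ?mul0r ?mulr0.
Qed.

Lemma lderivMX h : lderiv (h * lX f) = lderiv h * lX f + h.
Proof.
apply: laurent_eq => i; rewrite lcoefD !lderivE.
rewrite ![_ * lX f]mulrC lXE !lcoef_lmonoM !mul1r addrK lderivE subrK.
by rewrite intrD mulrDl mul1r.
Qed.

Lemma lderivM h k : lderiv (h * k) = lderiv h * k + h * lderiv k.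
Proof.
apply/eqP; rewrite -subr_eq0; apply/eqP.
apply: (termwise0
  (phi := fun k => lderiv (h * k) - (lderiv h * k + h * lderiv k))).
- by move=> x y; rewrite mulrDr !lderivD; lring.
- case: (lcoef_bounded h) => L hL M; exists (M - L + 1) => x xM.
  apply: val_geB; last apply: val_geD.
  + by apply: val_geW (val_ge_lderiv (val_geM hL xM)); lia.
  + by apply: val_geW (val_geM (val_ge_lderiv hL) xM); lia.
  + by apply: val_geW (val_geM hL (val_ge_lderiv xM)); lia.
- move=> c; have step x : lderiv (h * (x * lX f)) -
      (lderiv h * (x * lX f) + h * lderiv (x * lX f)) =
      (lderiv (h * x) - (lderiv h * x + h * lderiv x)) * lX f.
    by rewrite mulrA !lderivMX; lring.
  elim/int_shift_ind => [|i IHi|i].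
  + rewrite -lconstE lderiv_lconst mulr0 addr0; apply/eqP; rewrite subr_eq0.
    apply/eqP/laurent_eq => i.
    by rewrite ![_ * lconst c]mulrC lcoef_lconstM !lderivE lcoef_lconstM mulrCA.
  + by rewrite lmonoS step IHi mul0r.
  + rewrite lmonoS step => /eqP; rewrite mulf_eq0 (negbTE (lX_neq0 f)) orbF.
    by move/eqP.
Qed.

Lemma lderiv_Gal g h : Gal0 g ->
  lderiv (g h) = g (lderiv h) * lderiv (g (lX f)).
Proof.
move=> g0; apply/eqP; rewrite -subr_eq0; apply/eqP.
apply: (termwise0
  (phi := fun h => lderiv (g h) - g (lderiv h) * lderiv (g (lX f)))).
- by move=> x y; rewrite !(lderivD, rmorphD); lring.
- move=> M; exists (M + 1) => x xM; apply: val_geB.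
    by apply: val_geW (val_ge_lderiv (Gal_val_ge g0 xM)); lia.
  have dX := val_ge_lderiv (Gal_has_val_lX g0).1.
  by apply: val_geW (val_geM (Gal_val_ge g0 (val_ge_lderiv xM)) dX); lia.
- move=> c; have step x : lderiv (g (x * lX f)) -
      g (lderiv (x * lX f)) * lderiv (g (lX f)) =
      (lderiv (g x) - g (lderiv x) * lderiv (g (lX f))) * g (lX f).
    by rewrite lderivMX rmorphM lderivM rmorphD rmorphM; lring.
  elim/int_shift_ind => [|i IHi|i].
  + by rewrite -lconstE lderiv_lconst g0.2 lderiv_lconst rmorph0 mul0r subrr.
  + by rewrite lmonoS step IHi mul0r.
  + rewrite lmonoS step => /eqP.
    by rewrite mulf_eq0 fmorph_eq0 (negbTE (lX_neq0 f)) orbF => /eqP.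
Qed.

Lemma has_val_lderiv_lX g : Gal0 g -> has_val 0 (lderiv (g (lX f))).
Proof.
move=> /Gal_has_val_lX[s1 s0]; split; first exact: val_ge_lderiv s1.
by rewrite lderivE add0r mul1r.
Qed.

Lemma lderiv_Gal_eq0 g h : Gal0 g -> (lderiv (g h) == 0) = (lderiv h == 0).
Proof.
move=> g0; rewrite lderiv_Gal// mulf_eq0 fmorph_eq0.
by rewrite (negbTE (has_val_neq0 (has_val_lderiv_lX g0))) orbF.
Qed.

(** The first-order Taylor expansion of [h (s + e)].  The remainder [R] satisfies
    [R (x t) = R (x) s' + g (x') e^2], which carries the bound from one
    monomial to its neighbours in both directions. *)
Lemma taylor g g' j w h : Gal0 g -> Gal0 g' ->
  val_ge j (g' (lX f) - g (lX f)) -> val_ge w h ->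
  val_ge (w + j *+ 2 - 2) (g' h - g h - g (lderiv h) * (g' (lX f) - g (lX f))).
Proof.
move=> g0 g'0; set s' := g' _; set s := g _; set e := s' - s => sj.
apply: (termwise (phi := fun h => g' h - g h - g (lderiv h) * e)).
- by move=> x y; rewrite lderivD !rmorphD; lring.
- move=> M; exists (Num.max M (M + 1 - j)) => x xM.
  have xM1 : val_ge M x by apply: val_geW xM; lia.
  apply: val_geB; first by apply: val_geB; exact: Gal_val_ge.
  by apply: val_geW (val_geM (Gal_val_ge g0 (val_ge_lderiv xM)) sj); lia.
move=> c i wi.
set R := fun x => g' x - g x - g (lderiv x) * e.
suff : val_ge (i + j *+ 2 - 2) (R (lmono c i)) by apply: val_geW; lia.
have sub k : R (k * lX f) = R k * s' + g (lderiv k) * (e * e).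
  by rewrite /R lderivMX rmorphD !rmorphM -/s -/s' /e; lring.
have low k : val_ge (k - 1 + j *+ 2) (g (lderiv (lmono c k)) * (e * e)).
  rewrite mulr2n; apply: val_geM; last exact: val_geM.
  exact: Gal_val_ge g0 (val_ge_lderiv (val_ge_lmono c k)).
have s'1 : has_val 1 s' := Gal_has_val_lX g'0.
elim/int_shift_ind: i {wi} => [|i IHi|i IHi].
- by rewrite /R -lconstE g0.2 g'0.2 lderiv_lconst rmorph0 mul0r !subrr.
- rewrite lmonoS sub; apply: val_geD; last by apply: val_geW (low i); lia.
  by apply: val_geW (val_geM IHi s'1.1); lia.
rewrite lmonoS sub in IHi.
rewrite -(mulfK (has_val_neq0 s'1) (R _)).
have : val_ge (i + j *+ 2 - 1) (R (lmono c i) * s').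
  rewrite -(addrK (g (lderiv (lmono c i)) * (e * e)) (_ * s')).
  by apply: val_geB; [apply: val_geW IHi|apply: val_geW (low i)]; lia.
by move=> /val_ge_div/(_ s'1); apply: val_geW; lia.
Qed.

(** Newton iteration for [h (s) = k] in the unknown [s], starting at [t]. *)
Lemma Gorbit_ball n h : lderiv h != 0 ->
  exists N, forall k, val_ge N (k - h) -> Gorbit n h k.
Proof.
move=> /has_val_ex[v hv]; case: (lcoef_bounded h) => w hw.
have [ofs ofsP] : {ofs : F -> {rmorphism F -> F} &
    forall s, has_val 1 s -> Gal0 (ofs s) /\ ofs s (lX f) = s}.
  apply: (boolp.choice (P := fun s (g : {rmorphism F -> F}) =>
    has_val 1 s -> Gal0 g /\ g (lX f) = s)) => s.
  case: (pselect (has_val 1 s)) => [s1|ns1].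
    by have [g g0 gs] := exists_Gal0 s1; exists g.
  by exists idfun.
(* the first bound keeps [s] in [t + o(t^n)], the second one makes the
   quadratic remainder of Taylor's formula smaller than the error *)
pose N0 := Num.max (v + n%:Z + 2) (2 * v - w + 3); exists N0 => k kh.
have unif s : val_ge (N0 - v) (s - lX f) -> has_val 1 s.
  move=> sX; apply: (has_val_close (has_val_lX f)).
  by apply: val_geW sX; rewrite /N0; lia.
have [s sX sk] : exists2 s, val_ge (N0 - v) (s - lX f) & ofs s h = k.
  apply: (newton (Psi := fun s => ofs s h)).
  - move=> s /unif/ofsP[g0 gs] M; exists (M - w + 1) => s' /unif/ofsP[g'0 g's] s's.
    apply: val_geW (Gal_lipschitz (j := M - w + 1) g0 g'0 _ hw); first by lia.
    by rewrite gs g's.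
  - move=> N s N0N sX sk; have [g0 gs] := ofsP _ (unif _ sX).
    have dv := Gal_has_val g0 hv.
    pose d := (ofs s h - k) / ofs s (lderiv h).
    have dN : val_ge (N - v) d by exact: val_ge_div.
    have ds : s - d - s = - d by rewrite addrAC subrr sub0r.
    have s'X : val_ge (N0 - v) (s - d - lX f).
      rewrite addrAC; apply: val_geB => //; apply: val_geW dN; lia.
    have [g'0 g's] := ofsP _ (unif _ s'X).
    exists (s - d); first by rewrite ds; exact: val_geN.
    have := taylor (j := N - v) g0 g'0; rewrite gs g's ds => /(_ _ _ (val_geN dN) hw).
    have -> : ofs (s - d) h - ofs s h - ofs s (lderiv h) * - d = ofs (s - d) h - k.
      by rewrite mulrN opprK [_ * d]mulrC divfK ?(has_val_neq0 dv)//; lring.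
    by apply: val_geW; rewrite /N0 in N0N; lia.
  - have [g0 gX] := ofsP _ (has_val_lX f).
    by rewrite (Gal_eq g0 (Gal_id f 0).1 gX)/=; exact: val_geBC.
have [g0 gs] := ofsP _ (unif _ sX).
exists (ofs s) => //; split => // n0; rewrite gs.
by apply: val_geW sX; rewrite /N0; lia.
Qed.

Lemma laurent_openP (U : set F) :
  open U <-> forall h, U h -> exists N, forall k, val_ge N (k - h) -> U k.
Proof. by []. Qed.

Lemma laurent_closedP (A : set F) :
  closed A <-> forall h, (forall N, exists2 k, A k & val_ge N (k - h)) -> A h.
Proof.
rewrite -openC laurent_openP; split=> cA h.
  move=> hA; apply: contrapT => /cA[N kN].
  by have [k Ak kh] := hA N; exact: kN kh Ak.
move=> nAh; apply: contrapT => /forallNP H; apply: nAh; apply: cA => N.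
by have := H N; move=> /existsNP[k /not_implyP[kh /contrapT Ak]]; exists k.
Qed.

Section Characteristic.
Variable p : nat.
Hypothesis charp : has_characteristic f p.

Lemma intr_eq0_char i : (i%:~R == 0 :> f) = (p%:Z %| i)%Z.
Proof.
have -> : (i%:~R == 0 :> f) = ((absz i)%:R == 0 :> f).
  by case: (intP i) => [//|n|n]; rewrite ?mulrNz ?oppr_eq0 ?abszN.
rewrite /dvdz/=; case: charp => [pf|[-> c0]]; first by rewrite -(dvdn_pcharf pf).
by rewrite ((pcharf0P _).1 c0) -dvd0n.
Qed.

(** The coefficient of [t^i] in [h] has to vanish unless [i] is zero in [f]. *)
Lemma laurent_powP h : laurent_pow p h <-> lderiv h = 0.
Proof.
split=> [hp|h0 i].
  apply: laurent_eq => i; rewrite lderivE.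
  have [|/hp ->] := boolP (p%:Z %| i + 1)%Z; last by rewrite mulr0.
  by rewrite -intr_eq0_char => /eqP ->; rewrite mul0r.
rewrite -intr_eq0_char => i0; apply/eqP.
have /eqP : lderiv h (i - 1) = 0 by rewrite h0.
by rewrite lderivE subrK mulf_eq0 (negbTE i0).
Qed.

Lemma Gorbit_pow n h k : Gorbit n h k -> laurent_pow p h -> laurent_pow p k.
Proof.
move=> [g [g0 _] <-] /laurent_powP/eqP h0; apply/laurent_powP/eqP.
by rewrite lderiv_Gal_eq0.
Qed.

Lemma open_Gorbit n h : ~ laurent_pow p h -> open (Gorbit n h).
Proof.
move=> hp; apply/laurent_openP => k hk.
have /(Gorbit_ball n)[N kN] : lderiv k != 0.
  apply/eqP => /laurent_powP; move: hk => /Gorbit_sym/Gorbit_pow; tauto.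
by exists N => l /kN; exact: Gorbit_trans.
Qed.

(** Of two consecutive degrees, at least one is prime to [p], and adding a
    monomial of such a degree makes the derivative nonzero. *)
Lemma not_open_Gorbit n h : laurent_pow p h -> ~ open (Gorbit n h).
Proof.
move=> hp /laurent_openP/(_ h (Gorbit_refl n h))[N hN].
have [M NM pM] : exists2 M, N <= M & ~~ (p%:Z %| M)%Z.
  have [pN|] := boolP (p%:Z %| N)%Z; last by exists N.
  exists (N + 1); first by lia.
  rewrite -intr_eq0_char intrD; move: pN; rewrite -intr_eq0_char => /eqP ->.
  by rewrite add0r oner_neq0.
have : laurent_pow p (h + lmono 1 M).
  apply: Gorbit_pow hp; apply: hN; rewrite addrAC subrr add0r.
  by apply: val_geW (val_ge_lmono _ _).
by move=> /(_ M pM)/eqP; rewrite lcoefD hp// lmonoE eqxx add0r oner_eq0.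
Qed.

End Characteristic.


End Derivative.

(** * Limits of automorphisms and closed orbits *)

Section Closedness.
Variable f : fieldType.
Local Notation F := (laurent f).
Implicit Types (g : {rmorphism F -> F})
  (h x : F) (N M j v w : int) (n m i : nat) (c : f).
Add Ring laurent_ring : (laurent_ring_theory f).

(** A substitute for compactness: the digits of a limit point are found one
    at a time, and if no digit continued the prefix [a], one could pick an
    infinite sequence in [S N] of series extending [a] by distinct digits. *)
Lemma koenig (S : int -> set F) j0 a0 :
  (forall N M s, M <= N -> S N s -> S M s) ->
  (forall N, exists s, S N s) ->
  (forall N s, S N s -> val_ge j0 (s - a0)) ->
  (forall j, exists N, forall u : nat -> F, (forall i, S N (u i)) ->
     (forall i i', val_ge j (u i - u i')) ->
     exists i i', (i < i')%N /\ val_ge (j + 1) (u i' - u i)) ->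
  exists l, forall j N, exists2 s, S N s & val_ge j (s - l).
Proof.
move=> Sdec Sne S0 Sfin.
pose Q j a := forall N, exists2 s, S N s & val_ge j (s - a).
have step j a : Q j a -> exists2 a', val_ge j (a' - a) & Q (j + 1) a'.
  move=> Qa; apply: contrapT => nQ.
  have [Nf NfP] : {Nf : F -> int & forall a', val_ge j (a' - a) ->
      forall s, S (Nf a') s -> ~ val_ge (j + 1) (s - a')}.
    apply: (boolp.choice (P := fun a' N => val_ge j (a' - a) ->
      forall s, S N s -> ~ val_ge (j + 1) (s - a'))) => a'.
    have [a'a|] := pselect (val_ge j (a' - a)); last by exists 0.
    apply: contrapT => /forallNP H; apply: nQ; exists a' => // N.
    apply: contrapT => nN; apply: (H N) => _ s sN sa'; apply: nN.
    by exists s.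
  have [pick pickP] : {pick : int -> F & forall N,
      S N (pick N) /\ val_ge j (pick N - a)}.
    apply: (boolp.choice (P := fun N s => S N s /\ val_ge j (s - a))) => N.
    by have [s sN sa] := Qa N; exists s.
  have [N0 N0P] := Sfin j.
  (* each new element avoids the digits of all earlier ones *)
  pose M := fix M (i : nat) :=
    if i is i'.+1 then Num.max (M i') (Nf (pick (M i'))) else N0.
  have Mmono i i' : (i <= i')%N -> M i <= M i'.
    elim: i' => [|i' IH]; first by rewrite leqn0 => /eqP ->.
    rewrite leq_eqVlt ltnS => /orP[/eqP -> //|/IH iM].
    by rewrite /= le_max iM.
  have [i i'|i [i' [ii' close]]] := N0P (pick \o M)
    (fun i => Sdec _ _ _ (Mmono 0%N i isT) (pickP (M i)).1).
    exact: val_ge_trans (pickP (M i)).2 (val_geBC (pickP (M i')).2).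
  apply: NfP (pickP (M i)).2 _ _ close.
  apply: Sdec (pickP (M i')).1; apply: le_trans (Mmono _ _ ii').
  by rewrite /= le_max lexx orbT.
have [nx nxP] : {nx : nat * F -> F & forall kx, Q (j0 + kx.1%:Z) kx.2 ->
    val_ge (j0 + kx.1%:Z) (nx kx - kx.2) /\ Q (j0 + kx.1.+1%:Z) (nx kx)}.
  apply: (boolp.choice (P := fun (kx : nat * F) x' => Q (j0 + kx.1%:Z) kx.2 ->
    val_ge (j0 + kx.1%:Z) (x' - kx.2) /\ Q (j0 + kx.1.+1%:Z) x')) => -[k x] /=.
  have [/step[x' x'x Qx']|] := pselect (Q (j0 + k%:Z) x); last by exists 0.
  by exists x' => _; split => //; rewrite -addn1 PoszD addrA.
pose u := fix u k := if k is k'.+1 then nx (k', u k') else a0.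
have Qu k : Q (j0 + k%:Z) (u k).
  elim: k => [|k IHk]; last exact: (nxP (k, u k) IHk).2.
  by move=> N; have [s sN] := Sne N; exists s => //; rewrite addr0; exact: S0 sN.
have [l lu] := @laurent_complete _ u j0 (fun k => (nxP (k, u k) (Qu k)).1).
exists l => j N; have [s sN su] := Qu (absz (Num.max 0 (j - j0))) N.
exists s => //; apply: val_geW (val_ge_trans su (val_geBC (lu _))); lia.
Qed.

(** If the images of [t] under the automorphisms moving [x] near [A] have only
    finitely many candidates for each digit, then a limit point of these images
    defines an automorphism moving [x] into [A]. *)
Lemma Gal_limit n x (A : set F) : closed A ->
  (forall N, exists2 g, Gal n g & exists2 a, A a & val_ge N (g x - a)) ->
  (forall j, exists N, forall gs : nat -> {rmorphism F -> F},
    (forall i, Gal n (gs i) /\ exists2 a, A a & val_ge N (gs i x - a)) ->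
    (forall i i', val_ge j (gs i (lX f) - gs i' (lX f))) ->
    exists i i', (i < i')%N /\ val_ge (j + 1) (gs i' (lX f) - gs i (lX f))) ->
  exists2 g, Gal n g & A (g x).
Proof.
move=> cA near Afin; case: (lcoef_bounded x) => w xw.
pose S N s := exists2 g, Gal n g &
  g (lX f) = s /\ exists2 a, A a & val_ge N (g x - a).
have S1 N s : S N s -> has_val 1 s.
  by move=> [g [g0 _] [<- _]]; exact: Gal_has_val_lX.
have [||||l lS] := @koenig S 1 0.
- move=> N M s MN [g gn [gs [a Aa ax]]]; exists g => //; split => //.
  by exists a => //; exact: val_geW ax.
- move=> N; have [g gn [a Aa ax]] := near N.
  by exists (g (lX f)), g => //; split => //; exists a.
- by move=> N s /S1[s1 _]; rewrite subr0.
- move=> j; have [N NP] := Afin j; exists N => u uS uj.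
  have [gs gsP] : {gs : nat -> {rmorphism F -> F} & forall i, Gal n (gs i) /\
      (gs i (lX f) = u i /\ exists2 a, A a & val_ge N (gs i x - a))}.
    apply: (boolp.choice (P := fun i g => Gal n g /\
      (g (lX f) = u i /\ exists2 a, A a & val_ge N (g x - a)))) => i.
    by have [g gn gu] := uS i; exists g.
  have [i|i i'|i [i' ii']] := NP gs; first by have [? []] := gsP i.
    by rewrite (gsP i).2.1 (gsP i').2.1.
  by rewrite (gsP i).2.1 (gsP i').2.1 in ii'; exists i, i'.
have [s sS sl] := lS (Num.max 2 n.+1%:Z) 0.
have l1 : has_val 1 l.
  by apply: (has_val_close (S1 _ _ sS)); apply: val_geBC; apply: val_geW sl; lia.
have [g gn gl] : exists2 g, Gal n g & g (lX f) = l.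
  apply: exists_Gal => // n0; case: sS => g [_ gn] [gs _].
  apply: (@val_ge_trans _ _ _ s); last by rewrite -gs; exact: gn.
  by apply: val_geBC; apply: val_geW sl; lia.
exists g => //; move/laurent_closedP: cA; apply => N.
have [s' [g' g'n [g's' [a Aa ax]]] s'l] := lS (N - w + 1) N.
exists a => //; apply: val_ge_trans (val_geBC ax) _.
rewrite -g's' -gl in s'l.
by apply: val_geW (Gal_lipschitz gn.1 g'n.1 s'l xw); lia.
Qed.

(** The divided difference at the nodes [s i], ..., [s (i + r)] of a function
    with values [y i], ..., [y (i + r)] there. *)
Fixpoint ddiff (s y : nat -> F) (i r : nat) : F :=
  if r is r'.+1 then
    (ddiff s y i.+1 r' - ddiff s y i r') / (s (i + r'.+1)%N - s i)
  else y i.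

Section DividedDifferences.
Variable s : nat -> F.

Lemma eq_ddiff (y z : nat -> F) i r : y =1 z -> ddiff s y i r = ddiff s z i r.
Proof. by move=> yz; elim: r i => [|r IHr] i //=; rewrite !IHr. Qed.

Lemma ddiffD (y z : nat -> F) i r :
  ddiff s (fun k => y k + z k) i r = ddiff s y i r + ddiff s z i r.
Proof. by elim: r i => [|r IHr] i //=; rewrite !IHr; lring. Qed.

Lemma ddiff_const x i r : ddiff s (fun=> x) i r.+1 = 0.
Proof.
elim: r i => [|r IHr] i /=; first by rewrite subrr mul0r.
by rewrite -!/(ddiff s _ _ r.+1) !IHr subrr mul0r.
Qed.

Lemma val_ge_ddiff j N y i r :
  (forall k l, (k < l)%N -> ~ val_ge (j + 1) (s l - s k)) ->
  (forall k, val_ge N (y k)) -> val_ge (N - j *+ r) (ddiff s y i r).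
Proof.
move=> sj yN; elim: r i => [|r IHr] i /=; first by rewrite mulr0n subr0.
have ij : (i < i + r.+1)%N by lia.
have d0 : s (i + r.+1)%N - s i != 0.
  by apply/eqP => d0; apply: (sj _ _ ij); rewrite d0.
have [v dv] := has_val_ex d0.
have vj : v <= j.
  rewrite leNgt; apply/negP => jv; apply: (sj _ _ ij).
  by apply: val_geW dv.1; lia.
by apply: val_geW (val_ge_div (val_geB (IHr i.+1) (IHr i)) dv); rewrite mulrS; lia.
Qed.

Hypothesis s_inj : injective s.

Lemma node_neq i r : s (i + r.+1)%N - s i != 0.
Proof. by rewrite subr_eq0; apply/eqP => /s_inj; lia. Qed.

(** The Leibniz rule for the factor [t]; it determines the divided differences
    of all monomials. *)
Lemma ddiffM y i r : ddiff s (fun k => y k * s k) i r.+1 =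
  ddiff s y i r.+1 * s (i + r.+1)%N + ddiff s y i r.
Proof.
elim: r i => [|r IHr] i.
  apply: (mulIf (node_neq i 0)); rewrite /= divfK ?node_neq//.
  set a := _ - y i; rewrite mulrDl mulrAC divfK ?node_neq// /a addn1.
  by lring.
set A' := ddiff s y i r.+1; set A := ddiff s y i.+1 r.+1.
have BB : ddiff s y i.+1 r = A' * (s (i + r.+1)%N - s i) + ddiff s y i r.
  by rewrite /A' /= divfK ?node_neq// subrK.
rewrite -/(ddiff s (fun k => y k * s k) i r.+2).
apply: (mulIf (node_neq i r.+1)).
have -> : ddiff s (fun k => y k * s k) i r.+2 * (s (i + r.+2)%N - s i) =
  ddiff s (fun k => y k * s k) i.+1 r.+1 - ddiff s (fun k => y k * s k) i r.+1.
  by rewrite [ddiff s _ i r.+2]/= divfK ?node_neq.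
rewrite !IHr -/A -/A' BB [RHS]mulrDl [X in _ = X + _]mulrAC.
have -> : ddiff s y i r.+2 * (s (i + r.+2)%N - s i) = A - A'.
  by rewrite [ddiff s _ i r.+2]/= divfK ?node_neq.
by rewrite addSnnS; lring.
Qed.

Let monom c m (k : nat) := lconst c * s k ^+ m.

Lemma ddiff_monomS c m i r : ddiff s (monom c m.+1) i r.+1 =
  ddiff s (monom c m) i r.+1 * s (i + r.+1)%N + ddiff s (monom c m) i r.
Proof.
by rewrite -ddiffM; apply: eq_ddiff => k; rewrite /monom exprSr mulrA.
Qed.

Lemma ddiff_monom_lt c m i r : (m < r)%N -> ddiff s (monom c m) i r = 0.
Proof.
elim: m r i => [|m IHm] [|r] i //.
  by move=> _; rewrite -(ddiff_const (lconst c) i r); apply: eq_ddiff => k;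
    rewrite /monom mulr1.
by rewrite ltnS => mr; rewrite ddiff_monomS !IHm ?mul0r ?add0r// ltnW.
Qed.

Lemma ddiff_monom_eq c m i : ddiff s (monom c m) i m = lconst c.
Proof.
elim: m i => [|m IHm] i; first by rewrite /= /monom mulr1.
by rewrite ddiff_monomS IHm ddiff_monom_lt// mul0r add0r.
Qed.

Lemma val_ge_ddiff_monom c m i r : (forall k, val_ge 1 (s k)) -> (r <= m)%N ->
  val_ge (m - r)%N%:Z (ddiff s (monom c m) i r).
Proof.
move=> s1; elim: m r i => [|m IHm] [|r] i //.
- by move=> _; rewrite subnn /= /monom mulr1; exact: val_ge_lconst.
- move=> _; rewrite subn0 /= /monom; apply: val_ge_lconstM.
  by have := val_geX m.+1 (s1 i); rewrite natz.
rewrite ltnS subSS => rm; rewrite ddiff_monomS; apply: val_geD; last exact: IHm.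
have [e|rm'] := eqVneq r m; first by rewrite e ddiff_monom_lt// mul0r.
have rm1 : (r.+1 <= m)%N by lia.
by apply: val_geW (val_geM (IHm r.+1 i rm1) (s1 _)); lia.
Qed.

End DividedDifferences.

(** A series of positive valuation [v] takes almost the same value at no more
    than [v] far apart points of the maximal ideal: its divided difference at
    [v + 1] points is a unit, being the leading coefficient modulo terms of
    positive valuation, yet is small if all values are close to [k]. *)
Lemma few_preimages (v : nat) h k j : (0 < v)%N -> has_val v%:Z h ->
  exists N, forall gs : nat -> {rmorphism F -> F},
    (forall i, Gal0 (gs i) /\ val_ge N (gs i h - k)) ->
    exists i i', (i < i')%N /\ val_ge (j + 1) (gs i' (lX f) - gs i (lX f)).
Proof.
move=> v0 [hv h0].
(* [v] divisions by differences of valuation at most [j] still leave a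
   positive valuation *)
exists (j *+ v + 1) => gs gsP; apply: contrapT => nclose.
pose s i := gs i (lX f).
have sj i i' : (i < i')%N -> ~ val_ge (j + 1) (s i' - s i).
  by move=> ii' c; apply: nclose; exists i, i'.
have s_inj : injective s.
  move=> i i' e; case: (ltngtP i i') => // /sj []; by rewrite e subrr.
have s1 i : val_ge 1 (s i) by exact: (Gal_has_val_lX (gsP i).1).1.
pose phi x := ddiff s (fun i => gs i x) 0 v.
have phiD : {morph phi : x y / x + y}.
  by move=> x y; rewrite /phi -ddiffD; apply: eq_ddiff => i; rewrite rmorphD.
have phi_lmono c (m : nat) :
    phi (lmono c m%:Z) = ddiff s (fun i => lconst c * s i ^+ m) 0 v.
  by apply: eq_ddiff => i; rewrite (Gal_lmono _ _ (gsP i).1).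
have small : val_ge 1 (phi h).
  have -> : phi h = ddiff s (fun i => gs i h - k) 0 v.
    case: v v0 @phi {hv h0 gsP phiD phi_lmono} => // v _ phi.
    by rewrite ddiffD ddiff_const addr0.
  apply: val_geW (@val_ge_ddiff s j _ _ 0 v sj (fun i => (gsP i).2)).
  by rewrite addrAC subrr add0r.
have tail : val_ge 1 (phi (h - lmono (h v%:Z) v%:Z)).
  apply: (@termwise _ phi 1 (v%:Z + 1)) => //.
  - move=> M; exists (M + j *+ v) => x xM.
    have := @val_ge_ddiff s j _ _ 0 v sj (fun i => Gal_val_ge (gsP i).1 xM).
    by rewrite addrK.
  - move=> c i vi; have -> : i = (absz i)%:Z by lia.
    rewrite phi_lmono.
    have vi' : (v <= absz i)%N by lia.
    by apply: val_geW (@val_ge_ddiff_monom s s_inj c _ 0 v s1 vi'); lia.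
  - apply: val_geS; first by apply: val_geB => //; exact: val_ge_lmono.
    by rewrite lcoefB lmonoE eqxx subrr.
have : phi h 0 = h v%:Z.
  rewrite -{1}(subrK (lmono (h v%:Z) v%:Z) h) phiD lcoefD (tail 0)// add0r.
  by rewrite phi_lmono ddiff_monom_eq.
by rewrite small// => e; rewrite -e eqxx in h0.
Qed.

Lemma laurent_closed1 (k : F) : closed [set k].
Proof.
apply/laurent_closedP => h H; apply/eqP; rewrite -subr_eq0.
apply/eqP/val_ge_eq0 => N; apply: val_geBC.
by have [l -> ] := H N.
Qed.

Lemma Gorbit_limit_pos n (v : nat) h k : (0 < v)%N -> has_val v%:Z h ->
  (forall N, exists2 g, Gal n g & val_ge N (g h - k)) -> Gorbit n h k.
Proof.
move=> v0 hv hk.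
have [|||g gn gh] := @Gal_limit n h [set k]; last by exists g.
- exact: laurent_closed1.
- by move=> N; have [g gn gk] := hk N; exists g => //; exists k.
move=> j; have [N NP] := few_preimages k j v0 hv; exists N => gs gsP _.
by apply: NP => i; have [[g0 _] [_ -> gk]] := gsP i.
Qed.

(** Subtracting the constant term, and inverting if there is a pole, makes the
    valuation of a nonconstant series positive. *)
Lemma Gorbit_limit n h k :
  (forall N, exists2 g, Gal n g & val_ge N (g h - k)) -> Gorbit n h k.
Proof.
move=> hk; set c := h 0.
have hk1 N : exists2 g, Gal n g & val_ge N (g (h - lconst c) - (k - lconst c)).
  have [g gn gk] := hk N; exists g => //.
  by rewrite rmorphB (gn.1.2 c) opprB addrA subrK.
suff [g gn gh] : Gorbit n (h - lconst c) (k - lconst c).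
  exists g => //; apply: (addIr (- lconst c)).
  by rewrite -gh rmorphB (gn.1.2 c).
have [h0|] := eqVneq (h - lconst c) 0.
  exists idfun; first exact: Gal_id.
  rewrite h0; apply/esym/val_ge_eq0 => N; have [g gn] := hk1 N.
  by rewrite h0 rmorph0 sub0r => /val_geN; rewrite opprK.
have hc : (h - lconst c) 0 = 0 by rewrite lcoefB /= subrr.
move: (h - lconst c) (k - lconst c) hc hk1 => {hk c}h {}k h00 hk h0.
have [v hv] := has_val_ex h0.
have v0 : v != 0 by apply/eqP => e; move: hv => [_]; rewrite e h00 eqxx.
case: (ltP 0 v) => [vpos|vneg].
  apply: (@Gorbit_limit_pos _ (absz v)) => //; first by lia.
  by rewrite (_ : (absz v)%:Z = v)//; lia.
have kv : has_val v k.
  have [g gn gk] := hk (v + 1).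
  by apply: (has_val_close (Gal_has_val gn.1 hv)); exact: val_geBC.
have [|||g gn gh] := @Gorbit_limit_pos n (absz v) h^-1 k^-1.
- lia.
- by have := has_valV hv; rewrite (_ : - v = absz v)//; lia.
- move=> N; have [g gn gk] := hk (N + v *+ 2); exists g => //.
  have gv := Gal_has_val gn.1 hv.
  have -> : g h^-1 - k^-1 = - ((g h - k) / (g h * k)).
    rewrite fmorphV.
    apply: (mulIf (has_val_neq0 (has_valM gv kv))).
    rewrite mulNr divfK ?(has_val_neq0 (has_valM gv kv))// mulrBl.
    rewrite mulKf ?(has_val_neq0 gv)// [g h * k]mulrC mulKf ?(has_val_neq0 kv)//.
    by rewrite opprB.
  apply: val_geN; apply: val_geW (val_ge_div gk (has_valM gv kv)); lia.
by exists g => //; apply: invr_inj; rewrite -fmorphV.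
Qed.

Lemma closed_Gorbit n h : closed (Gorbit n h).
Proof.
apply/laurent_closedP => k hk; apply: Gorbit_limit => N.
by have [_ [g gn <-] gk] := hk N; exists g.
Qed.

Lemma finite_collision (u : nat -> f) : finite_set [set: f] ->
  exists i i', (i < i')%N /\ u i = u i'.
Proof.
move=> /finite_seqP[r rT]; apply: contrapT => ncoll.
have u_inj : injective u.
  move=> i i' e; case: (ltngtP i i') => // ii'; case: ncoll.
    by exists i, i'.
  by exists i', i.
have : (size (map u (iota 0 (size r).+1)) <= size r)%N.
  apply: uniq_leq_size; first by rewrite map_inj_uniq ?iota_uniq.
  by move=> x _; have : [set: f] x by []; rewrite rT.
by rewrite size_map size_iota ltnn.
Qed.

Definition saturation n (A : set F) : set F :=
  [set h | exists2 a, A a & Gorbit n a h].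

(** Compactness of [G_n]: the candidates for each digit are the elements of
    [f]. *)
Lemma closed_saturation_finite n (A : set F) : finite_set [set: f] -> closed A ->
  closed (saturation n A).
Proof.
move=> ffin cA; apply/laurent_closedP => h hA.
have [|j|g gn Agh] := @Gal_limit n h A cA; last first.
- by exists (g h) => //; apply: Gorbit_sym; exists g.
- exists 0 => gs _ gsj.
  have [i [i' [ii' e]]] := finite_collision (fun i => gs i (lX f) j) ffin.
  by exists i, i'; split => //; apply: val_geS; rewrite ?lcoefB ?e ?subrr.
move=> N; have [k [a Aa /Gorbit_sym[g gn gka]] kh] := hA N.
exists g => //; exists a => //; rewrite -gka -rmorphB.
by apply: Gal_val_ge gn.1 _; exact: val_geBC.
Qed.

End Closedness.

(** * Frobenius, perfect fields and normal forms *)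

Section Frobenius.
Variable f : fieldType.
Local Notation F := (laurent f).
Implicit Types (g : {rmorphism F -> F})
  (h k x y : F) (N M i j v w : int) (n m : nat) (c : f).
Add Ring laurent_ring : (laurent_ring_theory f).

Lemma lmonoX c i n : lmono c i ^+ n = lmono (c ^+ n) (i * n%:Z).
Proof.
elim: n => [|n IHn]; first by rewrite !expr0 mulr0 -lconstE.
by rewrite !exprS IHn lmonoM -[n.+1]addn1 PoszD mulrDr mulr1 [i + _]addrC.
Qed.

Lemma lhead_proof N h :
  exists M : int, forall i, i < M -> (if i < N then h i else 0) = 0.
Proof.
by case: (lcoef_bounded h) => M hM; exists M => i /hM ->; case: ifP.
Qed.

Definition lhead N h : F := Laurent (lhead_proof N h).

Lemma laurent_poly_lhead N h : laurent_poly (lhead N h).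
Proof. by exists N => i Ni /=; rewrite ltNge (ltW Ni). Qed.

Lemma val_ge_lhead N h : val_ge N (lhead N h - h).
Proof. by move=> i iN; rewrite lcoefB /= iN subrr. Qed.

Lemma laurent_pow_lhead q N h : laurent_pow q h -> laurent_pow q (lhead N h).
Proof. by move=> hq i /hq /= ->; case: ifP. Qed.

Section PositiveCharacteristic.
Variable p : nat.
Hypothesis pf : p \in [pchar f].

Let p_gt1 : (1 < p)%N.
Proof. exact/prime_gt1/(pcharf_prime pf). Qed.

Lemma laurent_pchar : p \in [pchar F].
Proof.
rewrite inE (pcharf_prime pf)/=; apply/eqP/laurent_eq => i.
have -> : (p%:R : F) i = (1 : F) i *+ p.
  by elim: p => // q; rewrite !mulrS lcoefD => ->.
by rewrite lcoef1 -mulrnA mulnC mulrnA (pcharf0 pf) mul0rn.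
Qed.

Lemma lcoef_Xp x i :
  (x ^+ p) i = if (p%:Z %| i)%Z then x (i %/ p%:Z)%Z ^+ p else 0.
Proof.
have frob_proof y : exists N : int, forall i, i < N ->
    (if (p%:Z %| i)%Z then y (i %/ p%:Z)%Z ^+ p else 0) = 0.
  case: (lcoef_bounded y) => N yN; exists (Num.min (N * p) 0) => j jN.
  case: ifP => // /divzK jp; rewrite yN ?expr0n ?(gtn_eqF (ltnW p_gt1))//.
  by nia.
pose frob y : F := Laurent (frob_proof y).
suff : x ^+ p - frob x = 0 by move=> /subr0_eq ->.
apply: (termwise0 (phi := fun x => x ^+ p - frob x)).
- move=> y z; have -> : frob (y + z) = frob y + frob z.
    apply: laurent_eq => j /=; case: ifP => _; last by rewrite addr0.
    by rewrite -!(pFrobenius_autE pf) pFrobenius_autD_comm//; exact: mulrC.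
  rewrite -!(pFrobenius_autE laurent_pchar) pFrobenius_autD_comm; last exact: mulrC.
  by lring.
- move=> M; exists (Num.max M 0) => y yM; apply: val_geB.
    by apply: val_geW (val_geX p yM); rewrite -mulr_natr natz; nia.
  move=> j jM /=; case: ifP => // /divzK jp.
  by rewrite yM ?expr0n ?(gtn_eqF (ltnW p_gt1))//; nia.
- move=> c j; apply/eqP; rewrite subr_eq0; apply/eqP/laurent_eq => l.
  rewrite lmonoX lmonoE /=; have [/divzK lp|npl] := boolP (p%:Z %| l)%Z.
    have -> : (l == j * p) = ((l %/ p)%Z == j) by apply/eqP/eqP; nia.
    by case: ifP; rewrite // expr0n (gtn_eqF (ltnW p_gt1)).
  by rewrite ifN//; apply: contra npl => /eqP ->; exact: dvdz_mull.
Qed.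

Lemma lcoef_Xp_mul x i : (x ^+ p) (i * p%:Z) = x i ^+ p.
Proof. by rewrite lcoef_Xp dvdz_mull// mulzK//; lia. Qed.

Lemma laurent_pow_Xp m x : laurent_pow (p ^ m) x -> laurent_pow (p ^ m.+1) (x ^+ p).
Proof.
move=> xm i ni; rewrite lcoef_Xp; case: ifP => // /divzK ip.
rewrite xm ?expr0n ?(gtn_eqF (ltnW p_gt1))//; apply: contra ni => mi.
by rewrite -ip expnSr PoszM dvdz_mul.
Qed.

Lemma val_ge_Xp N x : val_ge (N * p%:Z) (x ^+ p) -> val_ge N x.
Proof.
move=> xN i iN; have := expf_eq0 (x i) p.
by rewrite -lcoef_Xp_mul xN ?eqxx ?(ltnW p_gt1)/= => [/esym/eqP//|]; nia.
Qed.

Lemma laurent_perfect m h : perfect_field f -> laurent_pow (p ^ m.+1) h ->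
  exists2 x, h = x ^+ p & laurent_pow (p ^ m) x.
Proof.
move=> /(_ p pf) perf hm.
have hp0 i : h i != 0 -> (p%:Z %| i)%Z.
  apply: contraR => npi; rewrite hm//; apply: contra npi.
  by apply: dvdz_trans; rewrite expnS PoszM dvdz_mulr.
pose root c := projT1 (cid (perf c)).
have rootK c : root c ^+ p = c by exact: projT2 (cid (perf c)).
have root0 : root 0 = 0.
  by have := expf_eq0 (root 0) p; rewrite rootK eqxx (ltnW p_gt1) => /esym/eqP.
have xP : exists N : int, forall i, i < N -> root (h (i * p%:Z)) = 0.
  case: (lcoef_bounded h) => N hN; exists (Num.min N 0) => i iN.
  by rewrite hN//; nia.
exists (Laurent xP).
  apply: laurent_eq => i; rewrite lcoef_Xp /= rootK.
  case: ifPn => [/divzK -> //|npi].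
  by apply/eqP/negPn/negP => /hp0; exact/negP.
move=> i nmi /=; rewrite hm//; apply: contra nmi => /dvdzP[q].
rewrite expnSr PoszM mulrA => e; apply/dvdzP; exists q; apply: (mulIf _ e).
by lia.
Qed.

End PositiveCharacteristic.

Lemma relatively_open_ball (D A : set F) : A `<=` D ->
  (forall a, A a -> exists N, forall y, D y -> val_ge N (y - a) -> A y) ->
  relatively_open D A.
Proof.
move=> AD ball.
exists [set u | exists a N, [/\ A a, forall y, D y -> val_ge N (y - a) -> A y &
    val_ge N (u - a)]].
  apply/laurent_openP => u [a [N [Aa aN ua]]]; exists N => y yu.
  by exists a, N; split => //; exact: val_ge_trans yu ua.
apply/seteqP; split=> [a Aa|y [[a [N [Aa aN ya]]] Dy]]; last exact: aN.
split; last exact: AD.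
by have [N aN] := ball a Aa; exists a, N; split; rewrite ?subrr.
Qed.

(** Over a perfect field, [h] is the [p ^ m]-th power of a series with nonzero
    derivative, whose orbit is open, and automorphisms commute with powers. *)
Lemma perfect_orbit_ball p n m h : has_characteristic f p -> perfect_field f ->
  laurent_pow (p ^ m) h -> ~ laurent_pow (p ^ m.+1) h ->
  forall k, Gorbit n h k -> laurent_pow (p ^ m) k /\
    exists N, forall y, laurent_pow (p ^ m) y -> val_ge N (y - k) -> Gorbit n h y.
Proof.
move=> charp perf; elim: m h => [|m IHm] h hm nhm k hk.
  split; first by move=> i; rewrite expn0 dvd1z.
  move: nhm; rewrite expn1 => /(open_Gorbit (n := n) charp)/laurent_openP/(_ k hk).
  by move=> [N kN]; exists N => y _; exact: kN.
case: charp => [pf|[p0 _]]; last by move: nhm; rewrite p0 exp0n// in hm *.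
have [x hx xm] := laurent_perfect pf perf hm.
have nxm : ~ laurent_pow (p ^ m.+1) x.
  by move=> /(laurent_pow_Xp pf); rewrite -hx.
move: hk => [g gn gk]; have gx : Gorbit n x (g x) by exists g.
have [gxm [N gxN]] := IHm x xm nxm _ gx.
have kgx : k = g x ^+ p by rewrite -gk hx rmorphXn.
split; first by rewrite kgx; exact: laurent_pow_Xp.
exists (N * p%:Z) => y /(laurent_perfect pf perf)[z -> zm].
have -> : z ^+ p - k = (z - g x) ^+ p.
  by rewrite kgx -!(pFrobenius_autE (laurent_pchar pf)) rmorphB.
move=> /(val_ge_Xp pf)/(gxN z zm)[g' g'n g'z].
by exists g' => //; rewrite hx rmorphXn g'z.
Qed.

Lemma nonconstant_coef h : ~ range (@lconst f) h -> exists2 i, i != 0 & h i != 0.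
Proof.
move=> nh; apply: contrapT => H; apply: nh; exists (h 0) => //.
apply: laurent_eq => i /=; case: eqP => [->//|/eqP i0].
by apply/esym/eqP/negPn/negP => hi; apply: H; exists i.
Qed.

Lemma exact_pow p h : ~ range (@lconst f) h -> has_characteristic f p ->
  exists m, laurent_pow (p ^ m) h /\ ~ laurent_pow (p ^ m.+1) h.
Proof.
move=> /nonconstant_coef[i i0 hi] charp.
have big : exists m, ~~ `[< laurent_pow (p ^ m.+1) h >].
  exists (absz i); apply/asboolP => /(_ i) H; move/eqP: hi; apply; apply: H.
  case: charp => [pf|[-> _]]; last by rewrite exp0n// dvd0z.
  apply/negP; rewrite /dvdz/= => /dvdn_leq; rewrite absz_gt0 => /(_ i0).
  by have := ltn_expl (absz i).+1 (prime_gt1 (pcharf_prime pf)); lia.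
have [m /asboolP hm minm] := ex_minnP big.
exists m; split => //; case: m {hm} minm => [|m] minm.
  by move=> j; rewrite expn0 dvd1z.
by apply: contrapT => /asboolPn/minm; rewrite ltnn.
Qed.

(** In the orbit of [t^p] all coefficients are [p]-th powers, so if it is
    relatively open, then [t^p + x t^(p M)] lies in it for large [M]. *)
Lemma perfect_of_relatively_open p n : has_characteristic f p ->
  (forall h, ~ range (@lconst f) h -> forall m,
      laurent_pow (p ^ m) h -> ~ laurent_pow (p ^ m.+1) h ->
      relatively_open (laurent_pow (p ^ m)%N) (Gorbit n h)) ->
  perfect_field f.
Proof.
move=> charp H q qf x.
have pf : p \in [pchar f] by case: charp => // -[_ c0]; rewrite c0 in qf.
have {q qf} -> : q = p by move: qf; rewrite (pcharf_eq pf) inE => /eqP.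
have p1 : (1 < p)%N by exact/prime_gt1/(pcharf_prime pf).
have hE : lX f ^+ p = lmono 1 p%:Z by rewrite lXE lmonoX expr1n mul1r.
have hp : laurent_pow (p ^ 1) (lX f ^+ p).
  by apply: laurent_pow_Xp => // i; rewrite expn0 dvd1z.
have [||U oU eU] := H (lX f ^+ p) _ 1%N hp.
- move=> [c _ e]; have : lconst c p%:Z = lmono 1 p%:Z p%:Z by rewrite -hE e.
  rewrite lconstE !lmonoE eqxx (_ : (p%:Z == 0) = false); last by lia.
  by move/esym/eqP; rewrite oner_eq0.
- move=> /(_ p%:Z); rewrite hE lmonoE eqxx => H1.
  have /H1/eqP : ~~ ((p ^ 2)%N%:Z %| p%:Z)%Z by rewrite dvdzE/= gtnNdvd//; nia.
  by rewrite oner_eq0.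
have Uh : U (lX f ^+ p).
  by have : Gorbit n (lX f ^+ p) (lX f ^+ p) by [exact: Gorbit_refl]; rewrite eU => -[].
have [N UN] := (laurent_openP U).1 oU _ Uh.
(* degree [2 p] at least, to stay clear of the term [t^p] *)
pose M := Num.max 2 N.
have : Gorbit n (lX f ^+ p) (lX f ^+ p + lmono x (M * p%:Z)).
  rewrite eU; split.
    apply: UN; rewrite addrAC subrr add0r.
    by apply: val_geW (val_ge_lmono _ _); rewrite /M; nia.
  move=> i ni; rewrite lcoefD hp// lmonoE add0r ifN//; apply: contra ni => /eqP ->.
  by rewrite expn1 dvdz_mull.
move=> [g gn /(congr1 (fun a : F => a (M * p%:Z)))].
rewrite rmorphXn (lcoef_Xp_mul pf) lcoefD hE !lmonoE eqxx ifN ?add0r.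
  by exists (g (lX f) M).
by rewrite /M; nia.
Qed.

Lemma laurent_poly_top h i : laurent_poly h -> h i != 0 ->
  exists2 d, i <= d & h d != 0 /\ forall j, d < j -> h j = 0.
Proof.
move=> [N hN] hi.
have ex : exists m : nat, h (i + m%:Z) != 0 by exists 0%N; rewrite addr0.
have ub (m : nat) : h (i + m%:Z) != 0 -> (m <= absz (N - i))%N.
  by apply: contraR => Nm; apply/eqP/hN; lia.
have [m hm maxm] := ex_maxnP ex ub; exists (i + m%:Z); first by lia.
split => // j mj; apply/eqP/negPn/negP => hj.
have := maxm (absz (j - i)); rewrite (_ : i + (absz (j - i))%:Z = j); last by lia.
by move=> /(_ hj); lia.
Qed.

Lemma lcoefM_top x y d e : (forall j, d < j -> x j = 0) ->
  (forall j, e < j -> y j = 0) -> (x * y) (d + e) = x d * y e.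
Proof.
move=> xd ye; rewrite -[LHS]/(lmul_coef x y (d + e)) /lmul_coef.
rewrite (@fsbigE _ _ _ _ _ [:: d])//=.
  by rewrite big_cons big_nil in_setT addr0 addrAC subrr add0r.
move=> j _; rewrite inE => jd; have [dj|jd'] := ltP d j; first by rewrite xd ?mul0r.
by rewrite ye ?mulr0//; lia.
Qed.

(** If [a] is not a [p]-th power, then [t^p + a / (1 - t)^p] has no polynomial
    in its orbit: [s] and [1 / (1 - s)] would both be Laurent polynomials for
    [s] the image of [t], since [1] and [a] are linearly independent over the
    field of [p]-th powers. *)
Lemma perfect_of_normal_form n :
  (forall h : F, Gorbit n h `&` @laurent_poly f !=set0) -> perfect_field f.
Proof.
move=> H p pf a; apply: contrapT => na.
have p0 : (0 < p)%N by exact/prime_gt0/(pcharf_prime pf).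
have [_ [[g [g0 _] <-] [N polyN]]] := H (lX f ^+ p + lconst a * (1 - lX f)^-1 ^+ p).
move: polyN; set s := g (lX f); set r := g (1 - lX f)^-1 => polyN.
have s1 : has_val 1 s by exact: Gal_has_val_lX.
have q0 : has_val 0 (1 - s).
  by apply: has_valD; [exact: has_val1|exact: val_geN s1.1].
have rE : r = (1 - s)^-1 by rewrite /r fmorphV rmorphB rmorph1.
have sr i : Num.max N 0 < i -> s i = 0 /\ r i = 0.
  move=> Ni; have := polyN (i * p%:Z).
  rewrite rmorphD rmorphM !rmorphXn g0.2 -/s -/r lcoefD lcoef_lconstM.
  rewrite !(lcoef_Xp_mul pf) => /(_ _) e.
  have {}e : s i ^+ p + a * r i ^+ p = 0 by apply: e; nia.
  suff ri : r i = 0.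
    split => //; move: e; rewrite ri expr0n (gtn_eqF p0) mulr0 addr0 => /eqP.
    by rewrite expf_eq0 p0 => /eqP.
  apply/eqP/negPn/negP => ri; apply: na; exists (- s i / r i).
  rewrite expr_div_n -(pFrobenius_autE pf) rmorphN /= pFrobenius_autE.
  apply: (canLR (mulfK _)); rewrite ?expf_neq0//.
  by apply/esym/eqP; rewrite -addr_eq0 addrC e.
have polyr : laurent_poly r by exists (Num.max N 0) => i /sr[].
have polyq : laurent_poly (1 - s).
  exists (Num.max N 0) => i Ni; rewrite lcoefB (sr i Ni).1 lcoef1 subr0.
  by rewrite (_ : (i == 0) = false)//; lia.
have r0 : r 0 != 0 by rewrite rE; have [_] := has_valV q0; rewrite oppr0.
have q1 : (1 - s) 1 != 0 by rewrite lcoefB lcoef1 sub0r oppr_eq0; exact: s1.2.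
have [d d0 [rd rtop]] := laurent_poly_top polyr r0.
have [e e1 [qe qtop]] := laurent_poly_top polyq q1.
have := lcoefM_top rtop qtop; rewrite {1}rE mulVf ?(has_val_neq0 q0)// lcoef1.
rewrite (_ : (d + e == 0) = false); last by lia.
by move/esym/eqP; rewrite mulf_eq0 (negbTE rd) (negbTE qe).
Qed.

Lemma perfect_normal_form p n h : has_characteristic f p -> perfect_field f ->
  Gorbit n h `&` @laurent_poly f !=set0.
Proof.
move=> charp perf; have [[c _ <-]|nh] := pselect (range (@lconst f) h).
  exists (lconst c); split; first exact: Gorbit_refl.
  by exists 0 => i i0 /=; rewrite gt_eqF.
have [m [hm nhm]] := exact_pow nh charp.
have [_ [N hN]] := perfect_orbit_ball charp perf hm nhm (Gorbit_refl n h).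
exists (lhead N h); split; last exact: laurent_poly_lhead.
by apply: hN; [exact: laurent_pow_lhead|exact: val_ge_lhead].
Qed.

Lemma open_normal_form n h : lderiv h != 0 ->
  Gorbit n h `&` @laurent_poly f !=set0.
Proof.
move=> /(Gorbit_ball n)[N hN]; exists (lhead N h).
by split; [exact/hN/val_ge_lhead|exact: laurent_poly_lhead].
Qed.


(** * Saturations of closed sets and the quotient map *)

(** Orbits of nonconstant series are open and, being disjoint from the
    saturation or inside it, harmless; a constant is fixed by the isometries
    of [G_n], so it is as far from [A] as from its saturation. *)
Lemma closed_saturation_char0 n (A : set F) : has_characteristic f 0 ->
  closed A -> closed (saturation n A).
Proof.
move=> char0 cA; apply/laurent_closedP => h hA.
have [h0|nh0] := pselect (laurent_pow 0 h).
  have hE : h = lconst (h 0).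
    apply: laurent_eq => i /=; case: eqP => [->//|/eqP i0].
    by rewrite h0// dvd0z.
  exists h; last exact: Gorbit_refl.
  move/laurent_closedP: cA; apply => N.
  have [_ [a Aa [g gn <-]] gah] := hA N; exists a => //.
  have [g' [g'0 _] [g'g _]] := Gal_inv gn.
  rewrite hE -(g'0.2 (h 0)) -(g'g a) -rmorphB -hE.
  exact: Gal_val_ge.
have := open_Gorbit (n := n) char0 nh0 => /laurent_openP/(_ h (Gorbit_refl n h))[N hN].
have [k [a Aa ak] kh] := hA N; exists a => //.
by apply: Gorbit_trans ak _; apply/Gorbit_sym/hN.
Qed.

Lemma infinite_sequence : ~ finite_set [set: f] -> exists u : nat -> f, injective u.
Proof.
move=> finf.
have [nx nxP] : {nx : seq f -> f & forall r, nx r \notin r}.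
  apply: (boolp.choice (P := fun (r : seq f) (x : f) => is_true (x \notin r))) => r.
  apply: contrapT => /forallNP H; apply: finf; apply/finite_seqP; exists r.
  by apply/seteqP; split=> // x _; apply/negPn/negP/H.
pose r := fix r (k : nat) := if k is k'.+1 then nx (r k') :: r k' else [::].
have ur (i j : nat) : (i < j)%N -> nx (r i) \in r j.
  elim: j => // j IHj; rewrite ltnS leq_eqVlt => /orP[/eqP ->|/IHj ij] /=.
    by rewrite mem_head.
  by rewrite inE ij orbT.
exists (nx \o r) => i j /= e; case: (ltngtP i j) => // /ur; rewrite ?e.
  by rewrite (negbTE (nxP _)).
by rewrite -e (negbTE (nxP _)).
Qed.

(** For [u i] pairwise distinct, the series [g_i (t^p + t^(M_i))], where [g_i]
    maps [t] to [t + u_i t^(n+2)], are distinguished by their coefficients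
    [u_i ^ p] of degree [p (n + 2)], so they form a closed set; but their orbits
    accumulate at [t^p] when [M_i] grows, and do not contain [t^p] when [p]
    does not divide [M_i]. *)
Lemma not_closed_saturation p n : p \in [pchar f] -> ~ finite_set [set: f] ->
  exists2 A : set F, closed A & ~ closed (saturation n A).
Proof.
move=> pf /infinite_sequence[u u_inj].
have p1 : (1 < p)%N by exact/prime_gt1/(pcharf_prime pf).
pose s (i : nat) := lX f + lmono (u i) n.+2%:Z.
have [g gP] : {g : nat -> {rmorphism F -> F} &
    forall i : nat, Gal n (g i) /\ g i (lX f) = s i}.
  apply: (boolp.choice (P := fun (i : nat) (g : {rmorphism F -> F}) =>
    Gal n g /\ g (lX f) = s i)) => i.
  have si : val_ge n.+2%:Z (s i - lX f).
    by rewrite /s addrAC subrr add0r; exact: val_ge_lmono.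
  have [|_|g gn gs] := @exists_Gal f n (s i); last by exists g.
    by apply: has_val_close (has_val_lX f) _; apply: val_geW si; lia.
  by apply: val_geW si; lia.
pose M (i : nat) : int := (p * (n.+2 + i)).+1%:Z.
pose x (i : nat) := lX f ^+ p + lmono 1 (M i).
have coefx (i : nat) : g i (x i) (n.+2%:Z * p%:Z) = u i ^+ p.
  have [[g0 _] gs] := gP i.
  rewrite /x rmorphD rmorphXn gs lcoefD (lcoef_Xp_mul pf) lcoefD lXE !lmonoE eqxx add0r.
  by rewrite (Gal_val_ge g0 (val_ge_lmono _ _)) ?addr0// /M; nia.
exists [set g i (x i) | i in [set: nat]].
  apply/laurent_closedP => h hA; pose N0 : int := n.+2%:Z * p%:Z + 1.
  have [_ [i _ <-] ih] := hA N0; exists i => //.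
  apply/eqP; rewrite -subr_eq0; apply/eqP/val_ge_eq0 => N.
  have [_ [j _ <-] jh] := hA (Num.max N N0).
  suff ij : i = j by rewrite ij; apply: val_geW jh; lia.
  apply: u_inj; apply: (fmorph_inj (Frobenius_aut pf)).
  suff : u i ^+ p = u j ^+ p by [].
  rewrite -!coefx; apply/eqP; rewrite -subr_eq0 -lcoefB.
  have jh0 : val_ge N0 (g j (x j) - h) by apply: val_geW jh; lia.
  by apply/eqP/(val_ge_trans ih (val_geBC jh0)); rewrite /N0; lia.
move=> /laurent_closedP/(_ (lX f ^+ p))[N|_ [i _ <-]].
  exists (x (absz N)).
    exists (g (absz N) (x (absz N))); first by exists (absz N).
    by apply: Gorbit_sym; exists (g (absz N)) => //; exact: (gP _).1.
  rewrite /x addrAC subrr add0r; apply: val_geW (val_ge_lmono _ _).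
  by rewrite /M; nia.
have xi : Gorbit n (x i) (g i (x i)) by exists (g i) => //; exact: (gP i).1.
move=> /(Gorbit_trans xi)/Gorbit_sym/(Gorbit_pow (or_introl pf)).
have tp : laurent_pow p (lX f ^+ p).
  rewrite -[X in laurent_pow X]expn1; apply: laurent_pow_Xp => // j.
  by rewrite expn0 dvd1z.
have npM : ~~ (p%:Z %| M i)%Z.
  by rewrite /M dvdzE/= -addn1 dvdn_addr ?dvdn_mulr// dvdn1; lia.
move=> /(_ tp (M i) npM)/eqP.
by rewrite lcoefD tp// lmonoE eqxx add0r oner_eq0.
Qed.

Lemma orbit_projP n h k : orbit_proj n h = orbit_proj n k <-> Gorbit n h k.
Proof.
split=> [e|hk].
  suff : orbit_set (orbit_proj n h) k by [].
  by rewrite e; exact: Gorbit_refl.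
have e : Gorbit n h = Gorbit n k.
  apply/seteqP; split=> l; first exact/Gorbit_trans/Gorbit_sym.
  exact: Gorbit_trans.
rewrite /orbit_proj /orbit_of.
move: (ex_intro _ _ _) (ex_intro _ _ _).
by rewrite e => P Q; rewrite (Prop_irrelevance P Q).
Qed.

Lemma closed_map_orbit_proj n : closed_map (@orbit_proj f n) <->
  forall A : set F, closed A -> closed (saturation n A).
Proof.
have key A : closed (@orbit_proj f n @` A) <-> closed (saturation n A).
  rewrite -openC open_orbit_spaceE -[closed (saturation n A)]openC.
  have -> : orbit_proj n @^-1` (~` (@orbit_proj f n @` A)) = ~` saturation n A.
    apply/seteqP; split=> h /= nh [a Aa ah]; apply: nh; exists a => //.
      exact/orbit_projP.
    exact/orbit_projP.
  by [].
by split=> H A cA; apply/key/H.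
Qed.

End Frobenius.

(** * The metric on the orbit space *)

(** The metric takes the value [1 / (m + 1)] at two points that [E m] is the
    first to separate. *)
Lemma metric_of_equivalences (R : realType) (T : Type) (E : nat -> T -> T -> Prop) :
  (forall N x, E N x x) -> (forall N x y, E N x y -> E N y x) ->
  (forall N x y z, E N x y -> E N y z -> E N x z) ->
  (forall N x y, E N.+1 x y -> E N x y) ->
  (forall x y, (forall N, E N x y) -> x = y) ->
  exists d : T -> T -> R, is_metric d /\
    forall x y N, d x y < N.+1%:R^-1 <-> E N x y.
Proof.
move=> Exx Esym Etrans EW Esep.
pose spec x y (r : R) := (r = 0 /\ forall N, E N x y) \/
  exists m : nat, [/\ r = m.+1%:R^-1, ~ E m x y & forall N, (N < m)%N -> E N x y].
have [d dP] : {d : T * T -> R & forall xy, spec xy.1 xy.2 (d xy)}.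
  apply: (boolp.choice (P := fun (xy : T * T) r => spec xy.1 xy.2 r)) => -[x y] /=.
  have [allE|] := pselect (forall N, E N x y); first by exists 0; left.
  move=> /existsNP[m nEm].
  have ex : exists m, ~~ `[< E m x y >] by exists m; apply/asboolPn.
  have [m' /asboolPn nEm' minm'] := ex_minnP ex.
  exists m'.+1%:R^-1; right; exists m'; split => // N Nm.
  by apply: contrapT => /asboolPn/minm'; rewrite leqNgt Nm.
have dE x y N : d (x, y) < N.+1%:R^-1 <-> E N x y.
  have [[-> allE]|[m [-> nEm mE]]] := dP (x, y).
    by split => // _; rewrite invr_gt0.
  rewrite ltf_pV2 ?posrE// ltr_nat ltnS; split=> [/mE//|ENxy].
  rewrite ltnNge; apply/negP => mN; apply: nEm => /=.
  elim: N mN ENxy => [|N IHN]; first by rewrite leqn0 => /eqP ->.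
  by rewrite leq_eqVlt => /orP[/eqP -> //|/IHN {}IHN /EW].
exists (fun x y => d (x, y)); split => //; split.
- by move=> x y; have [[-> _]|[m [-> _ _]]] := dP (x, y); rewrite ?invr_ge0.
- move=> x y; split=> [d0|->].
    by apply: Esep => N; apply/dE; rewrite d0 invr_gt0.
  have [[-> //]|[m [_ /= nE _]]] := dP (y, y).
  by case: nE; exact: Exx.
- have le x y : d (y, x) <= d (x, y).
    have [[-> _]|[m [-> /= nE _]]] := dP (y, x); last first.
      by rewrite leNgt; apply/negP => /dE/Esym.
    by have [[-> _]|[m [-> _ _]]] := dP (x, y); rewrite ?invr_ge0.
  by move=> x y; apply/le_anti; rewrite !le.
- move=> x y z.
  have d0 a b : 0 <= d (a, b).
    by have [[-> _]|[m [-> _ _]]] := dP (a, b); rewrite ?invr_ge0.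
  have [[-> _]|[m [-> /= nE _]]] := dP (x, z); first exact: addr_ge0.
  have [/dE xy|xy] := ltP (d (x, y)) m.+1%:R^-1; last first.
    by apply: le_trans xy _; rewrite lerDl.
  have [/dE yz|yz] := ltP (d (y, z)) m.+1%:R^-1; last first.
    by apply: le_trans yz _; rewrite lerDr.
  by case: nE; exact: Etrans xy yz.
Qed.

Lemma exists_natSinv_lt (R : realType) (e : R) : 0 < e ->
  exists N : nat, N.+1%:R^-1 < e.
Proof.
move=> e0; exists (Num.bound e^-1); rewrite invf_plt ?posrE//.
apply: (lt_trans (archi_boundP _)); first by rewrite invr_ge0 ltW.
by rewrite ltr_nat.
Qed.

Section Metrization.
Variables (f : fieldType) (n : nat).
Local Notation F := (laurent f).
Implicit Types (h : F) (A B C : orbit_space f n).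

Let proj : F -> orbit_space f n := @orbit_proj f n.

Let proj_surj A : exists h, proj h = A.
Proof. by exists (orbit_repr A); exact: orbit_reprK. Qed.

Definition orbit_near (N : nat) A B :=
  exists h k, [/\ proj h = A, proj k = B & val_ge N%:Z (h - k)].

(** Since [G_n] acts by isometries, one of the two representatives can be
    prescribed; transitivity and the lifting of Cauchy sequences depend on
    this. *)
Lemma orbit_nearP N A (k : F) : orbit_near N A (proj k) <->
  exists2 h, proj h = A & val_ge N%:Z (h - k).
Proof.
split=> [[h [k' [hA /orbit_projP[g gn gk] hk]]]|[h hA hk]]; last by exists h, k.
exists (g h); last by rewrite -gk -rmorphB; exact: Gal_val_ge gn.1 hk.
by rewrite -hA; apply/esym/orbit_projP; exists g.
Qed.

Lemma orbit_near_refl N A : orbit_near N A A.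
Proof. by have [h <-] := proj_surj A; exists h, h; rewrite subrr. Qed.

Lemma orbit_near_sym N A B : orbit_near N A B -> orbit_near N B A.
Proof. by move=> [h [k [hA kB hk]]]; exists k, h; split => //; exact: val_geBC. Qed.

Lemma orbit_near_trans N A B C :
  orbit_near N A B -> orbit_near N B C -> orbit_near N A C.
Proof.
move=> AB [k [l [kB lC kl]]]; move: AB; rewrite -kB => /orbit_nearP[h hA hk].
by exists h, l; split => //; exact: val_ge_trans hk kl.
Qed.

Lemma orbit_nearW N A B : orbit_near N.+1 A B -> orbit_near N A B.
Proof.
by move=> [h [k [hA kB hk]]]; exists h, k; split => //; apply: val_geW hk; lia.
Qed.

(** This is the closedness of orbits. *)
Lemma orbit_near_sep A B : (forall N, orbit_near N A B) -> A = B.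
Proof.
have [h <-] := proj_surj A; have [k <-] := proj_surj B => hk.
apply/orbit_projP/Gorbit_limit => N.
have /orbit_nearP[_ /esym/orbit_projP[g gn <-] gk] := hk (absz (Num.max 0 N)).
by exists g => //; apply: val_geW gk; lia.
Qed.

Lemma open_orbit_near (U : set (orbit_space f n)) :
  open U <-> forall A, U A -> exists N, forall B, orbit_near N A B -> U B.
Proof.
rewrite open_orbit_spaceE laurent_openP; split=> [oU A|oU h Uh].
  have [h <-] := proj_surj A => /oU[N hN]; exists (absz (Num.max 0 N)) => B.
  move=> /orbit_near_sym/orbit_nearP[k <- kh]; apply: hN.
  by apply: val_geW kh; lia.
have [N UN] := oU _ Uh; exists N%:Z => k kh; apply: UN.
by apply/orbit_near_sym/orbit_nearP; exists k.
Qed.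

(** Successive representatives of a subsequence can be chosen ever closer to
    each other, and [F] is complete. *)
Lemma orbit_near_complete (u : nat -> orbit_space f n) :
  (forall j, exists N, forall m k, (N <= m)%N -> (N <= k)%N ->
     orbit_near j (u m) (u k)) ->
  exists A, forall j, exists N, forall m, (N <= m)%N -> orbit_near j (u m) A.
Proof.
move=> cu.
have [a aP] : {a : nat -> nat & forall j m k, (a j <= m)%N -> (a j <= k)%N ->
    orbit_near j (u m) (u k)}.
  exact: (boolp.choice (P := fun j N => forall m k, (N <= m)%N -> (N <= k)%N ->
    orbit_near j (u m) (u k))).
(* a nondecreasing majorant of [a] *)
pose b := fix b (j : nat) := if j is j'.+1 then maxn (b j') (a j) else a j.
have ab j : (a j <= b j)%N by case: j => //= j; rewrite leq_max leqnn orbT.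
have bS j : (b j <= b j.+1)%N by rewrite /= leq_max leqnn.
have [h0 h0u] := proj_surj (u (b 0%N)).
have [nx nxP] : {nx : nat * F -> F & forall jx, proj jx.2 = u (b jx.1) ->
    proj (nx jx) = u (b jx.1.+1) /\ val_ge jx.1%:Z (nx jx - jx.2)}.
  apply: (boolp.choice (P := fun (jx : nat * F) y => proj jx.2 = u (b jx.1) ->
    proj y = u (b jx.1.+1) /\ val_ge jx.1%:Z (y - jx.2))) => -[j x] /=.
  have [xu|] := pselect (proj x = u (b j)); last by exists 0.
  have : orbit_near j (u (b j.+1)) (proj x).
    by rewrite xu; apply: aP => //; exact: leq_trans (ab j) (bS j).
  by move=> /orbit_nearP[y yu yx]; exists y.
pose v := fix v (j : nat) := if j is j'.+1 then nx (j', v j') else h0.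
have vu j : proj (v j) = u (b j).
  by elim: j => [//|j IHj]; exact: (nxP (j, v j) IHj).1.
have vv j : val_ge (0 + j%:Z) (v j.+1 - v j).
  by rewrite add0r; exact: (nxP (j, v j) (vu j)).2.
have [l lv] := laurent_complete vv.
exists (proj l) => j; exists (b j) => m bm.
apply: (@orbit_near_trans _ _ (u (b j))).
  by apply: aP => //; exact: leq_trans (ab j) bm.
rewrite -vu; apply/orbit_nearP; exists (v j) => //.
by apply: val_geBC; have := lv j; rewrite add0r.
Qed.

Lemma orbit_space_completely_metrizable (R : realType) :
  completely_metrizable R (orbit_space f n).
Proof.
have [d [dm dE]] := metric_of_equivalences R orbit_near_refl orbit_near_sym
  orbit_near_trans orbit_nearW orbit_near_sep.
exists d; split => // [U|u cu].
  rewrite open_orbit_near; split=> oU A /oU.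
    move=> [N NU]; exists N.+1%:R^-1; first by rewrite invr_gt0.
    by move=> B /dE/NU.
  move=> [e e0 eU]; have [N Ne] := exists_natSinv_lt e0; exists N => B AB.
  by apply: eU; apply: lt_trans Ne; exact/dE.
have [|A uA] := @orbit_near_complete u.
  move=> j; have [|N NP] := cu j.+1%:R^-1; first by rewrite invr_gt0.
  by exists N => m k Nm Nk; apply/dE; exact: NP.
exists A => e e0; have [j je] := exists_natSinv_lt e0; have [N NP] := uA j.
by exists N => m Nm; apply: lt_trans je; apply/dE; exact: NP.
Qed.

End Metrization.

Theorem theorem9 (R : realType) (f : fieldType) (p : nat)
    (hp : has_characteristic f p) (n : nat) :
  (* (1) *)
  (forall h : laurent f, open (Gorbit n h) <-> ~ laurent_pow p h) /\
  (* (2) *)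
  ((forall h : laurent f, ~ range (@lconst f) h ->
    forall m : nat,
      laurent_pow (p ^ m)%N h -> ~ laurent_pow (p ^ m.+1)%N h ->
      relatively_open (laurent_pow (p ^ m)%N) (Gorbit n h))
   <-> perfect_field f) /\
  (* (3) *)
  (forall h : laurent f, ~ laurent_pow p h ->
    Gorbit n h `&` @laurent_poly f !=set0) /\
  (* (4) *)
  ((forall h : laurent f, Gorbit n h `&` @laurent_poly f !=set0)
   <-> perfect_field f) /\
  (* (5) *)
  (forall h : laurent f, closed (Gorbit n h)) /\
  (* (6) *)
  (closed_map (@orbit_proj f n) <-> (finite_set [set: f] \/ p = 0%N)) /\
  (* (7) *)
  completely_metrizable R (orbit_space f n).
Proof.
split; [|split; [|split; [|split; [|split; [|split]]]]].
- move=> h; split; last exact: open_Gorbit.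
  by move=> oh hpow; exact: (not_open_Gorbit hp hpow oh).
- split; first exact: perfect_of_relatively_open.
  move=> perf h _ m hm nhm; have ball := perfect_orbit_ball hp perf hm nhm.
  by apply: relatively_open_ball => k /ball[].
- move=> h nh; apply: open_normal_form; apply/eqP => /(laurent_powP hp).
  exact: nh.
- by split=> [/perfect_of_normal_form//|perf h]; exact: perfect_normal_form hp perf.
- exact: closed_Gorbit.
- rewrite closed_map_orbit_proj; split=> [H|[ffin A|p0 A]].
  + case: hp => [pf|[p0 _]]; last by right.
    left; apply: contrapT => /(not_closed_saturation n pf)[A cA].
    by apply; exact: H.
  + exact: closed_saturation_finite.
  + by apply: closed_saturation_char0; rewrite -p0.
- exact: orbit_space_completely_metrizable.
Qed.
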